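(* Let $F^*$ be the adjoint of the linearized forward operator $F$ (see context), let $\gamma,\eta\in L^\infty(\mathcal{B}_R)$ with $R=1$, and let $\Lambda=(\Lambda^{\omega_1},\Lambda^{\omega_2})^T=F(\gamma,\eta)^T$, with $\Phi$ the discretization of $F^*\Lambda$. Then for any $r,n_r\in\mathbb{N}$ (positive) satisfying $\frac{n_\theta}{n_r},\frac{n_\rho}{n_r}\in\mathbb{N}$ and $n_r^{2r}=c_rn_\theta$ for some constant $c_r>0$, there exists a neural network $\phi^1$ on the input $\Lambda$, obtained from the network $\phi^0$ of the context by replacing the matrix $K$ with an $n_r\times n_r$ block matrix $K_r\in\mathbb{C}^{n_\theta\times n_\rho}$ whose blocks (each of size $\frac{n_\theta}{n_r}\times\frac{n_\rho}{n_r}$) have rank at most $r$ and which satisfies $|K-K_r|_\infty\le(\frac{\pi}{2}\omega_2)^r(r!)^{-1}n_r^{-2r}$, such that $$|\Phi-\phi^1(\Lambda)|_{\infty}\leq c_{{\bf bf}_1} n_\theta^{-1},\qquad c_{{\bf bf}_1}=8\pi^2(|c_{\omega_1}|^2+|c_{\omega_2}|^2)\Big( (4\omega_2 +3)\pi+ \frac{(\frac{\pi}{2} \omega_2)^r}{r!\,c_r}\Big)\big(\|\eta\|_{L^1(\mathcal{B}_R)}+\|\gamma\|_{L^1(\mathcal{B}_R)}\big),$$ where $|\cdot|_\infty$ denotes the maximum magnitude of the entries of a matrix.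
   Context: $\mathbb{S}$ is the unit circle in $\mathbb{R}^2$, $\mathcal{B}_R$ the disc of radius $R$ centred at the origin, $R=1$; $0<\omega_1<\omega_2$ with $\omega_2/\omega_1\in\mathbb{N}$. $\gamma,\eta$ are scalar functions. For $\omega>0$ put $c_\omega=\frac{e^{i\pi/4}\omega^2}{\sqrt{8\pi\omega}}$ and $$[F_1^\omega\gamma](\hat x,\zeta)=-c_\omega\int_{\mathcal{B}_R}(\hat x\cdot\zeta)e^{i\omega(\zeta-\hat x)\cdot y}\gamma(y)\,dy,\qquad [F_2^\omega\eta](\hat x,\zeta)=c_\omega\int_{\mathcal{B}_R}e^{i\omega(\zeta-\hat x)\cdot y}\eta(y)\,dy,\qquad \hat x,\zeta\in\mathbb{S}.$$ $F=\begin{bmatrix} F_1^{\omega_1} & F_2^{\omega_1} \\ F_1^{\omega_2} & F_2^{\omega_2} \end{bmatrix}:(L^2(\mathcal{B}_R))^2\to(L^2(\mathbb{S}\times\mathbb{S}))^2$ with $L^2$ adjoint $F^*\Lambda=\sum_{i=1}^2\begin{bmatrix} F_1^{\omega_i*}\Lambda^{\omega_i} \\ F_2^{\omega_i*}\Lambda^{\omega_i} \end{bmatrix}$, where $$[F_1^{\omega*}\Lambda^\omega](y)=-\overline{c_\omega}\int_{\mathbb{S}\times\mathbb{S}}(\hat x\cdot\zeta)e^{i\omega(\hat x-\zeta)\cdot y}\Lambda^\omega(\hat x,\zeta)\,d\hat x\,d\zeta,\qquad [F_2^{\omega*}\Lambda^\omega](y)=\overline{c_\omega}\int_{\mathbb{S}\times\mathbb{S}}e^{i\omega(\hat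 x-\zeta)\cdot y}\Lambda^\omega(\hat x,\zeta)\,d\hat x\,d\zeta .$$ Points of $\mathbb{S}$ are identified with their angles (mod $2\pi$), and $y=(\rho\cos\theta,\rho\sin\theta)$ with polar coordinates $(\theta,\rho)$. Grids: $n_\theta\le n_\rho$ are positive integers with $n':=\frac{\omega_1}{\omega_2}n_\rho\in\mathbb{N}$. $\theta_m=t_m=\frac{2\pi m}{n_\theta}$ ($1\le m\le n_\theta$) and $\rho_n=\frac{\omega_2}{\omega_1}\frac{n}{n_\rho}$ ($1\le n\le n_\rho$; for the output only $1\le n\le n'$). The discretized input is $\Lambda=\begin{bmatrix} \Lambda^{\omega_1} \\ \Lambda^{\omega_2} \end{bmatrix}\in\mathbb{C}^{2n_\theta\times n_\theta}$ with $\Lambda^\omega[i,j]=\Lambda^\omega(\frac{2\pi i}{n_\theta},\frac{2\pi j}{n_\theta})$. $\Phi\in\mathbb{C}^{2n_\theta\times n'}$ is the discretization of $F^*\Lambda$: its upper (resp. lower) $n_\theta\times n'$ block has $(m,n)$-entry $\sum_{i=1}^2[F_1^{\omega_i*}\Lambda^{\omega_i}](\theta_m,\rho_n)$ (resp. $\sum_{i=1}^2[F_2^{\omega_i*}\Lambda^{\omega_i}](\theta_m,\rho_n)$), where $\Lambda^{\omega_i}$ here is the function. The network $\phi^0$: $$\phi^0(\Lambda)=\sum_{i=1}^2 \Big(P_u^T \big(\phi_1^0 R_1^{\omega_i}(\Lambda),\cdots,\phi_1^0 R_{n_\theta}^{\omega_i}(\Lambda) \big)^T P_{\omega_i}+ P_l^T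 \big(\phi_2^0 R_1^{\omega_i}(\Lambda),\cdots,\phi_2^0 R_{n_\theta}^{\omega_i}(\Lambda)\big)^T P_{\omega_i}\Big),$$ where $(v_1,\cdots,v_{n_\theta})^T$ is the matrix with $m$-th row $v_m$; $P_u=[I_{n_\theta}\;O_{n_\theta\times n_\theta}]$, $P_l=[O_{n_\theta\times n_\theta}\;I_{n_\theta}]$; $P_\omega\in\mathbb{R}^{n_\rho\times n'}$ has $P_\omega[i,j]=1$ if $i=\frac{\omega}{\omega_1}j$ and $0$ otherwise; the shifted inputs are $R_m^\omega(\Lambda)=\Lambda_{\theta_m}^\omega\in\mathbb{C}^{n_\theta\times n_\theta}$, $\Lambda_{\theta_m}^\omega[i,j]=\Lambda^\omega[i+m,j+m]$ (indices mod $n_\theta$); and $$\phi_1^0\Lambda_{\theta_m}^\omega=\frac{4\pi^2\overline{c_\omega}}{n_\theta^2}\mathrm{diag}\big(K^*(C\odot\Lambda_{\theta_m}^\omega)K\big),\qquad \phi_2^0\Lambda_{\theta_m}^\omega=\frac{4\pi^2\overline{c_\omega}}{n_\theta^2}\mathrm{diag}\big(K^*\Lambda_{\theta_m}^\omega K\big),$$ with $K\in\mathbb{C}^{n_\theta\times n_\rho}$, $K[i,j]=k(t_i,\rho_j)$, $k(t,\rho)=e^{-i\omega_1\rho\cos t}$; $C[i,j]=-\cos(\frac{2\pi(i-j)}{n_\theta})$; $K^*=\overline{K}^T$; $\odot$ the entrywise product; $\mathrm{diag}(A)$ the row vector of diagonal entries of $A$. In $\phi^1$, every occurrence of $K$ (including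 in $K^*$) is replaced by $K_r$. *)

(* Defs.v *)
From mathcomp Require Import all_boot all_order all_algebra complex.
From mathcomp Require Import all_classical all_reals all_analysis.

Set Implicit Arguments.
Unset Strict Implicit.
Unset Printing Implicit Defensive.

Import Order.TTheory GRing.Theory Num.Theory.
Import numFieldNormedType.Exports.

Local Open Scope classical_set_scope.
Local Open Scope ring_scope.
Local Open Scope complex_scope.

Notation cmod := Normc.normc.

Section Plane.
Context {R : realType}.
Implicit Types (u v : R * R) (t rho : R).

Definition expi t : R[i] := cos t +i* sin t.

Definition dot u v : R := u.1 * v.1 + u.2 * v.2.

Definition polar t rho : R * R := (rho * cos t, rho * sin t).

Definition circle_pt t : R * R := polar t 1.

Definition unit_disc : set (R * R) := [set y | dot y y <= 1].

Definition plane_measure := ((@lebesgue_measure R) \x (@lebesgue_measure R))%E.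

Definition cintegral (D : set (R * R)) (f : R * R -> R[i]) : R[i] :=
  (\int[plane_measure]_(y in D) complex.Re (f y)) +i*
  (\int[plane_measure]_(y in D) complex.Im (f y)).

(* A function on S x S is a function of two points of the plane; only its
   values at pairs of points of the unit circle matter, and it is integrated
   with respect to arc length in each variable. *)
Definition torus_integral (G : R * R -> R * R -> R[i]) : R[i] :=
  cintegral ([set` `[0, 2 * pi[%R] `*` [set` `[0, 2 * pi[%R])
    (fun a => G (circle_pt a.1) (circle_pt a.2)).

Definition disc_Lnorm (p : \bar R) (f : R * R -> R[i]) : \bar R :=
  ('N[plane_measure]_p [(fun y => (cmod (f y))%:E) \_ unit_disc])%E.

Definition disc_Linfty (f : R * R -> R[i]) : Prop :=
  [/\ measurable_fun unit_disc (fun y => complex.Re (f y)),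
      measurable_fun unit_disc (fun y => complex.Im (f y)) &
      (disc_Lnorm +oo f < +oo)%E].

Definition disc_L1norm (f : R * R -> R[i]) : R := fine (disc_Lnorm 1%E f).

End Plane.

Section ForwardOperator.
Context {R : realType}.
Implicit Types (omega : R) (x zeta y : R * R).

Definition coef omega : R[i] :=
  expi (pi / 4) * (omega ^+ 2 / Num.sqrt (8 * pi * omega))%:C.

Definition F1 omega (gamma : R * R -> R[i]) x zeta : R[i] :=
  - coef omega * cintegral unit_disc (fun y =>
      (dot x zeta)%:C * expi (omega * dot (zeta - x) y) * gamma y).

Definition F2 omega (eta : R * R -> R[i]) x zeta : R[i] :=
  coef omega * cintegral unit_disc (fun y =>
      expi (omega * dot (zeta - x) y) * eta y).

(* One block row of F, applied to the column (gamma, eta). *)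
Definition Frow omega (gamma eta : R * R -> R[i]) x zeta : R[i] :=
  F1 omega gamma x zeta + F2 omega eta x zeta.

Definition F1adj omega (L : R * R -> R * R -> R[i]) y : R[i] :=
  - (coef omega)^*%C * torus_integral (fun x zeta =>
      (dot x zeta)%:C * expi (omega * dot (x - zeta) y) * L x zeta).

Definition F2adj omega (L : R * R -> R * R -> R[i]) y : R[i] :=
  (coef omega)^*%C * torus_integral (fun x zeta =>
      expi (omega * dot (x - zeta) y) * L x zeta).

(* The two components of F^* (L1, L2), with Li the data at frequency omegai. *)
Definition Fstar1 omega1 omega2 (L1 L2 : R * R -> R * R -> R[i]) y : R[i] :=
  F1adj omega1 L1 y + F1adj omega2 L2 y.

Definition Fstar2 omega1 omega2 (L1 L2 : R * R -> R * R -> R[i]) y : R[i] :=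
  F2adj omega1 L1 y + F2adj omega2 L2 y.

End ForwardOperator.

(* All grid and matrix indices of the mathematics start at 1: the element i of
   'I_n stands for the index i.+1. *)
Section Grids.
Context {R : realType}.
Variables (omega1 omega2 : R) (ntheta nrho : nat).

Definition theta (i : nat) : R := 2 * pi * i.+1%:R / ntheta%:R.

Definition radius (j : nat) : R := omega2 / omega1 * (j.+1%:R / nrho%:R).

Definition sample (L : R * R -> R * R -> R[i]) : 'M[R[i]]_ntheta :=
  \matrix_(i, j) L (circle_pt (theta i)) (circle_pt (theta j)).

Definition discrete_input (L1 L2 : R * R -> R * R -> R[i]) :
    'M[R[i]]_(ntheta + ntheta, ntheta) :=
  col_mx (sample L1) (sample L2).

Definition discrete_output (n' : nat) (L1 L2 : R * R -> R * R -> R[i]) :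
    'M[R[i]]_(ntheta + ntheta, n') :=
  col_mx
    (\matrix_(m, n) Fstar1 omega1 omega2 L1 L2 (polar (theta m) (radius n)))
    (\matrix_(m, n) Fstar2 omega1 omega2 L1 L2 (polar (theta m) (radius n))).

Definition kernel (t rho : R) : R[i] := expi (- (omega1 * rho * cos t)).

Definition Kmx : 'M[R[i]]_(ntheta, nrho) :=
  \matrix_(i, j) kernel (theta i) (radius j).

End Grids.

Section Network.
Context {R : realType}.
Variables (omega1 omega2 : R) (ntheta nrho n' : nat).
Implicit Types (omega : R) (K : 'M[R[i]]_(ntheta, nrho)).

Definition hadamard (m n : nat) (A B : 'M[R[i]]_(m, n)) : 'M[R[i]]_(m, n) :=
  map2_mx *%R A B.

Definition conjtr (m n : nat) (A : 'M[R[i]]_(m, n)) : 'M[R[i]]_(n, m) :=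
  map_mx conjc A^T.

Definition diag_row (n : nat) (A : 'M[R[i]]_n) : 'rV[R[i]]_n := \row_j A j j.

(* With indices starting at 1, i + m reads i.+1 + m.+1, i.e. the ordinal
   (i + m.+1) mod ntheta. *)
Definition cyc_shift (m i : 'I_ntheta) : 'I_ntheta :=
  Ordinal (ltn_pmod (i + m.+1) (leq_ltn_trans (leq0n i) (ltn_ord i))).

Definition shifted (m : 'I_ntheta) (L : 'M[R[i]]_ntheta) : 'M[R[i]]_ntheta :=
  mxsub (cyc_shift m) (cyc_shift m) L.

Definition Cmx : 'M[R[i]]_ntheta :=
  \matrix_(i, j)
    (- cos (2 * pi * ((i : nat)%:R - (j : nat)%:R) / ntheta%:R))%:C.

Definition layer_scale omega : R[i] :=
  (4 * pi ^+ 2)%:C * (coef omega)^*%C / ntheta%:R ^+ 2.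

Definition layer1 omega K (L : 'M[R[i]]_ntheta) : 'rV[R[i]]_nrho :=
  layer_scale omega *: diag_row (conjtr K *m hadamard Cmx L *m K).

Definition layer2 omega K (L : 'M[R[i]]_ntheta) : 'rV[R[i]]_nrho :=
  layer_scale omega *: diag_row (conjtr K *m L *m K).

Definition Pu : 'M[R[i]]_(ntheta, ntheta + ntheta) := row_mx 1%:M 0.

Definition Pl : 'M[R[i]]_(ntheta, ntheta + ntheta) := row_mx 0 1%:M.

Definition Pomega omega : 'M[R[i]]_(nrho, n') :=
  \matrix_(i, j) (i.+1%:R == omega / omega1 * j.+1%:R :> R)%:R.

Definition network_at omega K (L : 'M[R[i]]_ntheta) :
    'M[R[i]]_(ntheta + ntheta, n') :=
  Pu^T *m (\matrix_m layer1 omega K (shifted m L)) *m Pomega omega +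
  Pl^T *m (\matrix_m layer2 omega K (shifted m L)) *m Pomega omega.

(* phi^0 is the network for K := Kmx; phi^1 is the network for K := K_r. *)
Definition network K (Lam : 'M[R[i]]_(ntheta + ntheta, ntheta)) :
    'M[R[i]]_(ntheta + ntheta, n') :=
  network_at omega1 K (usubmx Lam) + network_at omega2 K (dsubmx Lam).

End Network.

Section Blocks.

Lemma block_index_subproof (d n : nat) (dn : (d %| n)%N)
  (a : 'I_d) (i : 'I_(n %/ d)) : (a * (n %/ d) + i < n)%N.
Proof.
apply: (@leq_trans (a.+1 * (n %/ d))).
  by rewrite mulSnr ltn_add2l.
by rewrite -[leqRHS](divnK dn) mulnC leq_mul2l ltn_ord orbT.
Qed.

(* The i-th index of the a-th of d consecutive intervals of length n %/ d. *)
Definition block_index (d n : nat) (dn : (d %| n)%N)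
    (a : 'I_d) (i : 'I_(n %/ d)) : 'I_n :=
  Ordinal (block_index_subproof dn a i).

Definition block (T : Type) (d m n : nat) (dm : (d %| m)%N) (dn : (d %| n)%N)
    (A : 'M[T]_(m, n)) (a b : 'I_d) : 'M[T]_(m %/ d, n %/ d) :=
  mxsub (block_index dm a) (block_index dn b) A.

End Blocks.

Definition maxnorm {R : realType} {m n : nat} (A : 'M[R[i]]_(m, n)) : R :=
  \big[Num.max/0]_(i < m) \big[Num.max/0]_(j < n) cmod (A i j).

Definition c_bf1 {R : realType} (omega1 omega2 : R) (r : nat) (cr : R)
    (gamma eta : R * R -> R[i]) : R :=
  8 * pi ^+ 2 * (cmod (coef omega1) ^+ 2 + cmod (coef omega2) ^+ 2) *
  ((4 * omega2 + 3) * pi + (pi / 2 * omega2) ^+ r / (r`!%:R * cr)) *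
  (disc_L1norm eta + disc_L1norm gamma).

(* Main.v *)
(** With [omega1 * rho_j = omega2 * s], the phase [omega2 * s * cos t] on a block
    centred at [(t0, s0)] differs from a sum of a function of [t] and a function
    of [s] by [x = omega2 * (s - s0) * (cos t - cos t0)], and
    [|x| <= X = (pi / 2) * omega2 / nr ^ 2]. Replacing [exp (i x)] by a polynomial
    of degree less than [r] in [x] gives blocks of rank at most [r] with error
    [eps = X ^ r / r!]. The Taylor polynomial would leave an error
    [2 eps + eps ^ 2] in the products [conj K * K], too large for the claimed
    constant; a corrected polynomial brings it down to [2 eps].

    With [y0] the output point, the integrand of the adjoint is, up to [coef omega],
    the integral over the disc of [exp (i omega (x - zeta).(y0 - y))] times
    [- cos ^ 2 * gamma + cos * eta] (or [- cos * gamma + eta]), [cos] standing for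
    [x.zeta]. As [|y0 - y| <= 2], it is Lipschitz in the two angles with constant
    [|coef omega| (2 omega + 1) (|eta|_1 + |gamma|_1)], which bounds the quadrature
    error. By periodicity the quadrature sum is an entry of the network for the
    exact kernel. *)

Require Import Defs.
From mathcomp Require Import all_boot all_order all_algebra complex.
From mathcomp Require Import all_classical all_reals all_analysis.
From mathcomp Require Import measurable_realfun ess_sup_inf.
From mathcomp Require Import ring lra zify.

Import Order.TTheory GRing.Theory Num.Theory.
Import numFieldNormedType.Exports.

Set Implicit Arguments.
Unset Strict Implicit.
Unset Printing Implicit Defensive.

Local Open Scope ring_scope.
Local Open Scope complex_scope.

(** * Taylor remainder of the complex exponential *)

Section ComplexModulus.
Context {R : realType}.
Implicit Types (z w : R[i]) (t : R).

Lemma cmod_ge0 z : 0 <= cmod z.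
Proof. by case: z => a b; exact: sqrtr_ge0. Qed.

Lemma sqr_cmod z : cmod z ^+ 2 = complex.Re z ^+ 2 + complex.Im z ^+ 2.
Proof. by case: z => a b; rewrite sqr_sqrtr// addr_ge0// sqr_ge0. Qed.

Lemma cmod_conj z : cmod z^*%C = cmod z.
Proof. by case: z => a b /=; rewrite sqrrN. Qed.

Lemma cmodR t : cmod t%:C = `|t|.
Proof. by rewrite /= expr0n/= addr0 sqrtr_sqr. Qed.

Lemma cmod0 : cmod (0 : R[i]) = 0.
Proof. exact: Normc.normc0. Qed.

Lemma cmodM z w : cmod (z * w) = cmod z * cmod w.
Proof. exact: Normc.normcM. Qed.

Lemma cmodN z : cmod (- z) = cmod z.
Proof. exact: normcN. Qed.

Lemma cmodD z w : cmod (z + w) <= cmod z + cmod w.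
Proof. exact: le_normcD. Qed.

Lemma cmodX z n : cmod (z ^+ n) = cmod z ^+ n.
Proof.
elim: n => [|n IH]; first exact: Normc.normc1.
by rewrite !exprS cmodM IH.
Qed.

Lemma cmod_sum (I : Type) (s : seq I) (P : pred I) (F : I -> R[i]) :
  cmod (\sum_(i <- s | P i) F i) <= \sum_(i <- s | P i) cmod (F i).
Proof.
elim/big_rec2 : _ => [|i y1 y2 _ h]; first by rewrite cmod0.
by apply: le_trans (cmodD _ _) _; rewrite lerD2l.
Qed.

Lemma normr_Re_le z : `|complex.Re z| <= cmod z.
Proof.
by case: z => a b /=; rewrite -sqrtr_sqr ler_wsqrtr// lerDl sqr_ge0.
Qed.

Lemma normr_Im_le z : `|complex.Im z| <= cmod z.
Proof.
by case: z => a b /=; rewrite -sqrtr_sqr ler_wsqrtr// lerDr sqr_ge0.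
Qed.

Lemma Re_le_cmod z : complex.Re z <= cmod z.
Proof. by apply: le_trans (normr_Re_le z); exact: ler_norm. Qed.

Lemma ReD z w : complex.Re (z + w) = complex.Re z + complex.Re w.
Proof. by case: z w => [a b] [c d]. Qed.

Lemma ReB z w : complex.Re (z - w) = complex.Re z - complex.Re w.
Proof. by case: z w => [a b] [c d]. Qed.

Lemma ImB z w : complex.Im (z - w) = complex.Im z - complex.Im w.
Proof. by case: z w => [a b] [c d]. Qed.

Lemma ReZ t z : complex.Re (t%:C * z) = t * complex.Re z.
Proof. by case: z => [a b] /=; rewrite mul0r subr0. Qed.

Lemma Re_sum (I : Type) (s : seq I) (P : pred I) (F : I -> R[i]) :
  complex.Re (\sum_(i <- s | P i) F i) = \sum_(i <- s | P i) complex.Re (F i).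
Proof. by elim/big_rec2 : _ => // i y1 y2 _ <-; rewrite ReD. Qed.

Lemma conjM_cmod z : z^*%C * z = (cmod z ^+ 2)%:C.
Proof.
rewrite sqr_cmod; case: z => a b /=; apply/eqP; rewrite eq_complex /=.
by apply/andP; split; apply/eqP; ring.
Qed.

Lemma cmod_expi t : cmod (expi t) = 1.
Proof. by rewrite /= cos2Dsin2 sqrtr1. Qed.

Lemma expiD s t : expi (s + t) = expi s * expi t.
Proof.
by apply/eqP; rewrite eq_complex /= cosD sinD; apply/andP; split; apply/eqP; ring.
Qed.

Lemma conjc_expi t : (expi t)^*%C = expi (- t).
Proof. by rewrite /expi /= cosN sinN. Qed.

Lemma expi0 : expi 0 = 1 :> R[i].
Proof. by rewrite /expi cos0 sin0. Qed.

End ComplexModulus.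

Section ExpRemainder.
Context {R : realType}.
Implicit Types (w : R[i]) (x : R) (r : nat).

(** The mean value theorem applied to [g - f] on [[0, x]]. It replaces integration in the inductions
    on the order of the Taylor remainder. *)
Lemma derive_le (f g df dg : R -> R) x :
  (forall y, is_derive y (1 : R) f (df y)) ->
  (forall y, is_derive y (1 : R) g (dg y)) ->
  f 0 <= g 0 -> (forall y, 0 <= y -> df y <= dg y) -> 0 <= x -> f x <= g x.
Proof.
move=> hf hg h0 hd x0.
have hB y : is_derive y (1 : R) (g - f) (dg y - df y) by exact: is_deriveB.
have [c] : exists2 c, c \in `[0, x] &
    (g - f) x - (g - f) 0 = (dg c - df c) * (x - 0).
  apply: MVT_segment => //.
  apply: continuous_subspaceT => y; apply: differentiable_continuous.
  by apply/derivable1_diffP; case: (hB y).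
rewrite in_itv /= => /andP[c0 _] e.
have : 0 <= (g - f) x - (g - f) 0.
  by rewrite e subr0 mulr_ge0 ?subr_ge0// hd.
rewrite !fctE; lra.
Qed.

Lemma is_derive_pow_fact (c : R) r x :
  is_derive x (1 : R) (fun y => c * (y ^+ r.+1 / r.+1`!%:R)) (c * (x ^+ r / r`!%:R)).
Proof.
have := @is_deriveZ R _ _ _ (c / r.+1`!%:R) x 1 _
    (@is_deriveX _ _ id r.+1 x 1 _ (is_derive_id _ _)).
rewrite scaler1 (_ : _ \*: _ = fun y => c * (y ^+ r.+1 / r.+1`!%:R)); last first.
  by apply/funext => y /=; rewrite exprfctE [LHS]mulrAC mulrA.
congr is_derive; rewrite /= factS natrM [LHS]/GRing.scale /=.
have h1 : r.+1%:R != 0 :> R by rewrite pnatr_eq0.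
have h2 : r`!%:R != 0 :> R by rewrite pnatr_eq0 -lt0n fact_gt0.
by field; rewrite h2 nat1r h1.
Qed.

Definition exp_taylor r x : R[i] := \sum_(k < r) 'i%C ^+ k * (x ^+ k / k`!%:R)%:C.

Definition exp_rem r x : R[i] := expi x - exp_taylor r x.

Lemma exp_rem0 r : exp_rem r.+1 0 = 0.
Proof.
rewrite /exp_rem /exp_taylor big_ord_recl big1 => [|i _].
  by rewrite expi0 !expr0 fact0 divr1 mul1r addr0 subrr.
by rewrite expr0n /= mul0r mulr0.
Qed.

(** Differentiation turns the remainder of order [r.+1] into [i] times that of order [r]. The
    arbitrary factor [w] keeps the derivative a real one while covering real and imaginary parts
    together. *)
Lemma is_derive_exp_rem w r x :
  is_derive x (1 : R) (fun y => complex.Re (w * exp_rem r.+1 y))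
    (complex.Re (w * 'i%C * exp_rem r x)).
Proof.
have e y : complex.Re (w * exp_rem r.+1 y) =
   complex.Re w * cos y - complex.Im w * sin y -
   \sum_(k < r.+1) complex.Re (w * 'i%C ^+ k) / k`!%:R * y ^+ k.
  rewrite /exp_rem mulrBr ReB /exp_taylor mulr_sumr Re_sum; congr (_ - _).
    by case: w => a b.
  by apply: eq_bigr => k _; rewrite mulrA mulrC ReZ mulrC mulrA mulrAC.
rewrite (_ : (fun y => _) = (fun y => complex.Re w * cos y) -
   (fun y => complex.Im w * sin y) - \sum_(k < r.+1)
   (fun y => complex.Re (w * 'i%C ^+ k) / k`!%:R * y ^+ k)); last first.
  by apply/funext => y; rewrite e !fctE fct_sumE.
pose d := complex.Re w * - sin x - complex.Im w * cos x - \sum_(k < r.+1)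
   (complex.Re (w * 'i%C ^+ k) / k`!%:R * (k%:R * x ^+ k.-1)).
suff -> : complex.Re (w * 'i%C * exp_rem r x) = d.
  apply: is_deriveB; apply: is_derive_sum => k.
  have := @is_deriveZ R _ _ _ (complex.Re (w * 'i%C ^+ k) / k`!%:R) x 1 _
    (@is_deriveX _ _ id k x 1 _ (is_derive_id _ _)).
  rewrite scaler1 (_ : _ \*: _ = fun y => complex.Re (w * 'i%C ^+ k) / k`!%:R * y ^+ k)//.
  by apply/funext => y /=; rewrite exprfctE.
(* The constant term disappears, and the others, shifted by one, give [i] times the Taylor
   polynomial with [r] terms. *)
rewrite /d big_ord_recl /= mul0r mulr0 add0r /exp_rem mulrBr ReB; congr (_ - _).
  by case: w {e d} => a b /=; ring.
rewrite /exp_taylor mulr_sumr Re_sum; apply: eq_bigr => k _.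
rewrite mulrA mulrC ReZ exprS mulrA factS natrM /bump /= add1n add0n.
have h1 : k.+1%:R != 0 :> R by rewrite pnatr_eq0.
have h2 : k`!%:R != 0 :> R by rewrite pnatr_eq0 -lt0n fact_gt0.
by field; rewrite h2 nat1r h1.
Qed.

(** Induction on [r], comparing derivatives: these are the two sides for [w * i] at order [r], and
    [w * i] has the modulus of [w]. Hence the quantification over [w]. *)
Lemma exp_rem_Re_le r w x : 0 <= x ->
  complex.Re (w * exp_rem r x) <= cmod w * (x ^+ r / r`!%:R).
Proof.
elim: r w x => [|r IH] w x x0.
  rewrite /exp_rem /exp_taylor big_ord0 subr0 expr0 fact0 divr1.
  by apply: (le_trans (Re_le_cmod _)); rewrite cmodM cmod_expi.
apply: (@derive_le _ (fun y => cmod w * (y ^+ r.+1 / r.+1`!%:R)) _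
  (fun y => cmod w * (y ^+ r / r`!%:R)) x (is_derive_exp_rem w r)) => //.
- move=> y; exact: is_derive_pow_fact.
- by rewrite exp_rem0 mulr0 expr0n /= mul0r mulr0.
move=> y y0; apply: le_trans (IH _ _ y0) _.
by rewrite cmodM [cmod 'i%C]/= expr0n /= add0r expr1n sqrtr1 mulr1.
Qed.

(* Rotating by the conjugate of the remainder turns the real-part bound into a
   modulus bound. *)
Lemma cmod_exp_rem_le r x : 0 <= x -> cmod (exp_rem r x) <= x ^+ r / r`!%:R.
Proof.
move=> x0; set z := exp_rem r x; have := exp_rem_Re_le r z^*%C x0.
rewrite -/z conjM_cmod /= cmod_conj expr2.
have [->|zn0] := eqVneq (cmod z) 0.
  by rewrite divr_ge0 // exprn_ge0.
by rewrite ler_pM2l// lt_neqAle eq_sym zn0 cmod_ge0.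
Qed.

(** The remainder points nearly in the direction [i ^ r] of its leading term: after rotation, the
    first correction to the real part has order [r + 2]. The factor [(- i) ^ r] absorbs the [i]
    produced by each differentiation. This direction is what the corrected polynomial exploits. *)
Lemma exp_rem_Re_ge r x : 0 <= x ->
  x ^+ r / r`!%:R - x ^+ r.+2 / r.+2`!%:R <= complex.Re ((- 'i%C) ^+ r * exp_rem r x).
Proof.
elim: r x => [|r IH] x x0.
  (* At order 0 the claim is [1 - x ^ 2 / 2 <= cos x], the real-part bound of order 2 with
     [w = -1]. *)
  have := @exp_rem_Re_le 2 (-1) x x0.
  rewrite cmodN Normc.normc1 !mulN1r /exp_rem /exp_taylor big_ord0 !big_ord_recr big_ord0.
  rewrite expr0 fact0 expr0 divr1 !mul1r /= !factS fact0 !mul0r.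
  lra.
have hd y : is_derive y (1 : R) (fun y => complex.Re ((- 'i%C) ^+ r.+1 * exp_rem r.+1 y))
    (complex.Re ((- 'i%C) ^+ r * exp_rem r y)).
  have := is_derive_exp_rem ((- 'i%C) ^+ r.+1) r y.
  by rewrite exprSr -(mulrA ((- 'i%C) ^+ r)) mulNr -expr2 sqr_i opprK mulr1.
have hl y : is_derive y (1 : R) (fun y => y ^+ r.+1 / r.+1`!%:R - y ^+ r.+3 / r.+3`!%:R)
    (y ^+ r / r`!%:R - y ^+ r.+2 / r.+2`!%:R).
  have := is_deriveB (is_derive_pow_fact 1 r y) (is_derive_pow_fact 1 r.+2 y).
  rewrite !mul1r; congr is_derive.
  by apply/funext => t; rewrite !fctE !mul1r.
apply: (derive_le hl hd _ IH) => //.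
by rewrite exp_rem0 mulr0 !expr0n /= !mul0r subr0.
Qed.

End ExpRemainder.

(** * Corrected Taylor polynomials of the exponential *)

Lemma bernoulli_nat a n : (a ^ n + n * a ^ n.-1 <= a.+1 ^ n)%N.
Proof.
elim: n => [|n IH]; first by rewrite mul0n addn0.
apply: (@leq_trans (a.+1 * (a ^ n + n * a ^ n.-1))); last first.
  by rewrite [leqRHS]expnS leq_mul2l IH orbT.
case: n {IH} => [|n]; first by rewrite !expn0 expn1; lia.
by rewrite /= !expnS; nia.
Qed.

(** By induction: passing from [r] to [r + 1] multiplies the left side by [2 (r + 1)], and Bernoulli
    with [a = n = r + 1] gives [2 (r + 1) ^ (r + 1) <= (r + 2) ^ (r + 1)]. *)
Lemma fact_le_half_pow r : (r`! * 2 ^ r <= r.+1 ^ r)%N.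
Proof.
elim: r => // r IH; apply: leq_trans (bernoulli_nat r.+1 r.+1).
rewrite factS !expnS /=; move: IH; set a := (r.+1 ^ r)%N; nia.
Qed.

Section ExpPolyApprox.
Context {R : realType}.
Implicit Types (x y X : R) (r : nat).

(** The hypothesis yields [(2 X) ^ r <= (r + 1) ^ r], so [2 X <= r + 1]. The conclusion makes the
    term of order [r + 2] at most a quarter of the term of order [r]. *)
Lemma sqr_le_of_exp_le_fact X r : (0 < r)%N -> 0 <= X -> X ^+ r <= r`!%:R ->
  4 * X ^+ 2 <= (r.+1 * r.+2)%:R.
Proof.
move=> r0 X0 h; have : (2 * X) ^+ r <= r.+1%:R ^+ r.
  rewrite exprMn; apply: (@le_trans _ _ (2 ^+ r * r`!%:R)).
    by rewrite ler_pM2l// exprn_gt0.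
  by rewrite -!natrX -natrM ler_nat mulnC fact_le_half_pow.
rewrite ler_pXn2r ?nnegrE ?mulr_ge0// => h2.
have -> : 4 * X ^+ 2 = (2 * X) * (2 * X) by ring.
by rewrite natrM; apply: ler_pM => //; rewrite ?mulr_ge0//; apply: (le_trans h2); rewrite ler_nat.
Qed.

(** The first omitted term [i ^ r x ^ r / r!] is partly restored without reaching degree [r]: two
    factors [x] become the constant [X]. The phase and the parity of that term are kept. *)
Definition exp_poly r X x : R[i] :=
  exp_taylor r x + 'i%C ^+ r * (2 / 3 * (X ^+ 2 * x ^+ (r - 2)) / r`!%:R)%:C.

(** After rotation by [(- i) ^ r] the error is [z - c], with [z] the rotated remainder and [c] the
    real correction. An upper bound on the modulus of [z] and a lower bound on its real part give
    [|z - c| <= c]. *)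
Lemma expi_sub_exp_poly r X x : (1 < r)%N -> X ^+ r <= r`!%:R -> 0 <= x <= X ->
  cmod (expi x - exp_poly r X x) <= 2 / 3 * (X ^+ r / r`!%:R).
Proof.
move=> r1 hX /andP[x0 xX]; have X0 := le_trans x0 xX.
have r0 : (0 < r)%N by apply: ltnW.
have X2 := sqr_le_of_exp_le_fact r0 X0 hX.
set c := 2 / 3 * (X ^+ 2 * x ^+ (r - 2)) / r`!%:R.
pose z := (- 'i%C) ^+ r * exp_rem r x.
have ci : cmod (- 'i%C : R[i]) = 1.
  by rewrite cmodN /= expr0n /= add0r expr1n sqrtr1.
have -> : cmod (expi x - exp_poly r X x) = cmod (z - c%:C).
  rewrite -[LHS]mul1r -[X in X * _](expr1n R r) -{1}ci -cmodX -cmodM.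
  congr cmod; rewrite /exp_poly opprD addrA -/(exp_rem r x) mulrBr -/z; congr (_ - _).
  by rewrite mulrA -exprMn mulNr -expr2 sqr_i opprK expr1n mul1r.
have hz : cmod z <= x ^+ r / r`!%:R.
  by rewrite /z cmodM cmodX ci expr1n mul1r cmod_exp_rem_le.
have hR := exp_rem_Re_ge r x0; rewrite -/z in hR.
have f0 : 0 < r`!%:R :> R by rewrite ltr0n fact_gt0.
set u := x ^+ (r - 2) / r`!%:R.
have u0 : 0 <= u by rewrite divr_ge0 ?exprn_ge0// ltW.
have et : x ^+ r / r`!%:R = u * x ^+ 2.
  by rewrite /u mulrAC -exprD subnK.
have ec : c = 2 / 3 * (u * X ^+ 2) by rewrite /c /u; field; rewrite gt_eqF.
(* By [X2] the term of order [r + 2] takes away at most a quarter of [u * x ^ 2]. *)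
have hR2 : 3 / 4 * (u * x ^+ 2) <= complex.Re z.
  apply: le_trans hR; rewrite et.
  have -> : x ^+ r.+2 / r.+2`!%:R = u * x ^+ 2 * (x ^+ 2 / (r.+1 * r.+2)%:R).
    by rewrite -et mulf_div -exprD addn2 -natrM !factS mulnA
      [(r.+2 * r.+1)%N]mulnC [X in _ / X%:R]mulnC.
  have hb : x ^+ 2 / (r.+1 * r.+2)%:R <= 1 / 4.
    rewrite ler_pdivrMr ?ltr0n// (le_trans (_ : _ <= X ^+ 2))//.
      by rewrite lerXn2r// nnegrE.
    by lra.
  have ha : 0 <= u * x ^+ 2 by rewrite mulr_ge0// sqr_ge0.
  have := ler_wpM2l ha hb; move: (u * x ^+ 2 * _) => a. lra.
rewrite -(@ler_pXn2r _ 2)// ?nnegrE ?cmod_ge0//; last first.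
  by rewrite mulr_ge0// divr_ge0 ?exprn_ge0// ltW.
have -> : cmod (z - c%:C) ^+ 2 = cmod z ^+ 2 - 2 * c * complex.Re z + c ^+ 2.
  by rewrite !sqr_cmod; case: (z) => a b /=; ring.
have xX2 : x ^+ 2 <= X ^+ 2 by rewrite lerXn2r// nnegrE.
have -> : X ^+ r / r`!%:R = X ^+ (r - 2) / r`!%:R * X ^+ 2.
  by rewrite mulrAC -exprD subnK.
have hu : u <= X ^+ (r - 2) / r`!%:R.
  by rewrite ler_pM2r ?invr_gt0// lerXn2r// nnegrE.
have hk (v : R) : 0 <= v -> 0 <= 2 / 3 * (v * X ^+ 2).
  by move=> v0; rewrite !mulr_ge0// sqr_ge0.
apply: (@le_trans _ _ ((2 / 3 * (u * X ^+ 2)) ^+ 2)); last first.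
  rewrite lerXn2r ?nnegrE ?hk ?(le_trans u0 hu)//.
  by rewrite ler_pM2l// ler_wpM2r// sqr_ge0.
have hz2 : cmod z ^+ 2 <= (u * x ^+ 2) ^+ 2.
  by rewrite -et lerXn2r ?nnegrE ?cmod_ge0// et mulr_ge0// sqr_ge0.
have hc : c * (3 / 4 * (u * x ^+ 2)) <= c * complex.Re z.
  by rewrite ler_wpM2l// ec hk.
(* As [2 * (2 / 3) * (3 / 4) = 1], the square of [|z - c|] is at most
   [c ^ 2 - u ^ 2 x ^ 2 (X ^ 2 - x ^ 2)], hence at most [c ^ 2]. *)
move: hz2 hc; rewrite ec => hz2 hc.
have : 0 <= u ^+ 2 * x ^+ 2 * (X ^+ 2 - x ^+ 2).
  by rewrite mulr_ge0 ?subr_ge0// mulr_ge0 ?sqr_ge0.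
move: hz2 hc; set M := cmod z ^+ 2; set Z := complex.Re z.
lra.
Qed.

Lemma conjcM (z w : R[i]) : (z * w)^*%C = z^*%C * w^*%C.
Proof. exact: (rmorphM (@conjc R)). Qed.

Lemma conjcD (z w : R[i]) : (z + w)^*%C = z^*%C + w^*%C.
Proof. exact: (raddfD (@conjc R)). Qed.

Lemma conjcB (z w : R[i]) : (z - w)^*%C = z^*%C - w^*%C.
Proof. exact: (raddfB (@conjc R)). Qed.

Lemma conjc_sum (I : Type) (s : seq I) (P : pred I) (F : I -> R[i]) :
  (\sum_(i <- s | P i) F i)^*%C = \sum_(i <- s | P i) (F i)^*%C.
Proof. exact: (raddf_sum (@conjc R)). Qed.

Lemma conjcX k (z : R[i]) : (z ^+ k)^*%C = z^*%C ^+ k.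
Proof. exact: (rmorphXn (@conjc R)). Qed.

Lemma real_complexM (a b : R) : (a * b)%:C = a%:C * b%:C.
Proof. exact: (rmorphM (real_complex R)). Qed.

Lemma real_complex_signM k (t : R) : ((-1) ^+ k * t)%:C = (-1) ^+ k * t%:C.
Proof.
elim: k t => [|k IH] t; first by rewrite !expr0 !mul1r.
rewrite !exprSr -!mulrA IH mulN1r mulN1r; congr (_ * _).
exact: (rmorphN (real_complex R)).
Qed.

Lemma conjc_iXM k (t : R) :
  ('i%C ^+ k * t%:C)^*%C = 'i%C ^+ k * ((-1) ^+ k * t)%:C.
Proof.
rewrite conjcM conjcX conjc_real (_ : 'i%C^*%C = - 'i%C :> R[i]).
  rewrite real_complex_signM [in LHS]exprNn.
  by rewrite mulrCA mulrA.
by apply/eqP; rewrite eq_complex /= oppr0 !eqxx.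
Qed.

Lemma conjc_exp_taylor r x : exp_taylor r (- x) = (exp_taylor r x)^*%C.
Proof.
rewrite /exp_taylor conjc_sum; apply: eq_bigr => k _ /=.
by rewrite conjc_iXM mulrA -exprNn.
Qed.

(** Conjugation changes [i ^ r] by [(-1) ^ r], and [r - 2] has the parity of [r]. This symmetry,
    shared with [expi], extends the error bound to negative [x]. *)
Lemma conjc_exp_poly r X x : (1 < r)%N -> exp_poly r X (- x) = (exp_poly r X x)^*%C.
Proof.
move=> r1; rewrite /exp_poly conjcD conjc_exp_taylor; congr (_ + _).
rewrite conjc_iXM [(- x) ^+ _]exprNn (_ : (-1) ^+ (r - 2) = (-1) ^+ r :> R).
  by congr (_ * _%:C); ring.
by rewrite -[in RHS](subnK r1) exprD sqrrN expr1n mulr1.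
Qed.

Lemma cmod_expi_sub_exp_poly r X x : (1 < r)%N -> X ^+ r <= r`!%:R -> `|x| <= X ->
  cmod (expi x - exp_poly r X x) <= 2 / 3 * (X ^+ r / r`!%:R).
Proof.
move=> r1 hX; have [x0|x0] := lerP 0 x => xX.
  by apply: expi_sub_exp_poly => //; rewrite x0 -(ger0_norm x0).
rewrite -[x]opprK -conjc_expi conjc_exp_poly// -conjcB cmod_conj.
by apply: expi_sub_exp_poly => //; rewrite oppr_ge0 ltW// -(ltr0_norm x0).
Qed.

Lemma cmod_expi_sub1 x : cmod (expi x - 1) <= `|x|.
Proof.
have h y : 0 <= y -> cmod (expi y - 1) <= y.
  move=> y0; have := cmod_exp_rem_le 1 y0.
  by rewrite /exp_rem /exp_taylor big_ord1 !expr0 fact0 !expr1 !divr1 mul1r.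
have [x0|x0] := lerP 0 x; first by rewrite ger0_norm// h.
rewrite -[x in expi x]opprK -conjc_expi -(conjc1 R) -conjcB cmod_conj ltr0_norm//.
by apply: h; rewrite oppr_ge0 ltW.
Qed.

(** The [r] coefficients are what later bounds the rank by [r]: one separable term for each power of
    [x]. *)
Lemma exp_poly_coef r X : (1 < r)%N -> exists c : nat -> R[i],
  forall x, exp_poly r X x = \sum_(k < r) c k * (x ^+ k)%:C.
Proof.
move=> r1; exists (fun k => 'i%C ^+ k * (k`!%:R^-1)%:C +
  (k == r - 2)%N%:R * ('i%C ^+ r * (2 / 3 * X ^+ 2 / r`!%:R)%:C)) => x.
under eq_bigr do rewrite mulrDl.
rewrite big_split /=; congr (_ + _).
  by apply: eq_bigr => k _; rewrite -mulrA -real_complexM [k`!%:R^-1 * _]mulrC.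
have r2 : (r - 2 < r)%N by rewrite ltn_subrL/= ltnW.
rewrite (bigD1 (Ordinal r2)) //= eqxx mul1r big1 ?addr0 => [|k kr].
  by rewrite -[RHS]mulrA -real_complexM; congr (_ * _%:C); ring.
have /negbTE -> : (k : nat) != (r - 2)%N by [].
by rewrite !mul0r.
Qed.

(* For [1 < r] the extra monomial in [exp_poly] gains the factor 2/3 that absorbs
   the quadratic term of the product error; for [r = 1] the approximant is
   unimodular, and once [X ^+ r >= r!] the zero polynomial does. *)
Lemma expi_poly_approx r X : (0 < r)%N -> 0 <= X -> exists c : nat -> R[i],
  let P x := \sum_(k < r) c k * (x ^+ k)%:C in
  (forall x, `|x| <= X -> cmod (expi x - P x) <= X ^+ r / r`!%:R) /\
  (forall x y, `|x| <= X -> `|y| <= X ->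
     cmod ((expi x)^*%C * expi y - (P x)^*%C * P y) <= 2 * (X ^+ r / r`!%:R)).
Proof.
move=> r0 X0; have f0 : 0 < r`!%:R :> R by rewrite ltr0n fact_gt0.
have [e1|e1] := lerP (r`!%:R) (X ^+ r).
  have h1 : 1 <= X ^+ r / r`!%:R by rewrite ler_pdivlMr// mul1r.
  exists (fun=> 0) => P; have P0 x : P x = 0 by rewrite /P big1// => k _; rewrite mul0r.
  split=> [x _|x y _ _]; rewrite !P0 ?mulr0 subr0 ?cmodM ?cmod_conj !cmod_expi//.
  by rewrite mulr1; lra.
have [r1|r1] := ltnP 1 r; last first.
  have -> : r = 1%N by apply/eqP; rewrite eqn_leq r1.
  exists (fun=> 1) => P; have P1 x : P x = 1 by rewrite /P big_ord1 expr0 mulr1.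
  rewrite expr1 (_ : 1`! = 1%N)// divr1; split=> [x xX|x y xX yX]; rewrite !P1.
    exact: le_trans (cmod_expi_sub1 _) xX.
  rewrite conjc1 mulr1 conjc_expi -expiD; apply: (le_trans (cmod_expi_sub1 _)).
  by apply: (le_trans (ler_normD _ _)); rewrite normrN; lra.
have [c cE] := exp_poly_coef X r1; exists c => P.
have hP x : `|x| <= X -> cmod (expi x - P x) <= 2 / 3 * (X ^+ r / r`!%:R).
  by move=> xX; rewrite /P -cE cmod_expi_sub_exp_poly// ltW.
have e0 : 0 <= X ^+ r / r`!%:R by rewrite divr_ge0 ?exprn_ge0// ltW.
have e2 : X ^+ r / r`!%:R <= 1 by rewrite ler_pdivrMr// mul1r ltW.
move: hP e0 e2; set e := X ^+ r / _ => hP e0 e2.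
split=> [x xX|x y xX yX]; first by apply: le_trans (hP _ xX) _; lra.
have -> : (expi x)^*%C * expi y - (P x)^*%C * P y =
  (expi x)^*%C * (expi y - P y) + (expi x - P x)^*%C * P y.
  by rewrite conjcB; ring.
apply: (le_trans (cmodD _ _)); rewrite !cmodM !cmod_conj cmod_expi mul1r.
have hPy : cmod (P y) <= 1 + 2 / 3 * e.
  rewrite (_ : P y = expi y + - (expi y - P y)); last by ring.
  by apply: (le_trans (cmodD _ _)); rewrite cmod_expi cmodN lerD2l hP.
(* The two terms add up to at most [2/3 e + 2/3 e (1 + 2/3 e) <= 16/9 e], using [e <= 1]. *)
have := ler_pM (cmod_ge0 _) (cmod_ge0 _) (hP _ xX) hPy.
have := hP _ yX; have := mulr_ge0 e0 (_ : 0 <= 1 - e); rewrite subr_ge0 => /(_ e2).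
move: (cmod _) (cmod _ * cmod _) => u v.
lra.
Qed.

End ExpPolyApprox.

(** * Low-rank blocks *)

Section LowRankKernel.
Context {R : realType}.
Implicit Types (a b t : R) (n nr : nat).

Lemma cmod_expiB a b : cmod (expi a - expi b) <= `|a - b|.
Proof.
have -> : expi a - expi b = expi b * (expi (a - b) - 1).
  by rewrite mulrBr mulr1 -expiD [b + _]addrC subrK.
by rewrite cmodM cmod_expi mul1r cmod_expi_sub1.
Qed.

Lemma cos_lipschitz a b : `|cos a - cos b| <= `|a - b|.
Proof.
apply: le_trans (cmod_expiB a b).
by have := normr_Re_le (expi a - expi b); rewrite ReB.
Qed.

(** With indices from 0, the grid point of index [i] is [i.+1 / n]. Those of the [a]-th block lie in
    the interval from [a / nr] to [(a + 1) / nr], whose midpoint this is. *)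
Definition block_center n nr (i : nat) : R := ((i %/ (n %/ nr))%:R + 2^-1) / nr%:R.

Lemma block_center_dist n nr i : (0 < n)%N -> (nr %| n)%N -> (0 < nr)%N ->
  `|i.+1%:R / n%:R - block_center n nr i| <= 2^-1 / nr%:R.
Proof.
move=> n0 dn nr0; rewrite /block_center; set q := (n %/ nr)%N.
have nE : n = (q * nr)%N by rewrite divnK.
have q0 : (0 < q)%N by move: n0; rewrite nE muln_gt0 => /andP[].
have iE := divn_eq i q; have := ltn_pmod i q0.
move: (i %/ q)%N (i %% q)%N iE => a j -> jq.
have q0' : 0 < q%:R :> R by rewrite ltr0n.
have nr0' : 0 < nr%:R :> R by rewrite ltr0n.
have -> : (a * q + j).+1%:R / n%:R - (a%:R + 2^-1) / nr%:R =
    (j.+1%:R / q%:R - 2^-1) / nr%:R :> R.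
  rewrite nE natrM -addnS natrD natrM; field.
  by rewrite !gt_eqF.
rewrite normrM [X in _ * X]ger0_norm ?invr_ge0// ler_pM2r ?invr_gt0//.
have h0 : 0 <= j.+1%:R / q%:R :> R by rewrite divr_ge0.
have h1 : j.+1%:R / q%:R <= 1 :> R by rewrite ler_pdivrMr// mul1r ler_nat.
by rewrite ler_norml; apply/andP; split; lra.
Qed.

Lemma maxnorm_le m n (A : 'M[R[i]]_(m, n)) (M : R) : 0 <= M ->
  (forall i j, cmod (A i j) <= M) -> maxnorm A <= M.
Proof.
move=> M0 h; rewrite /maxnorm; elim/big_ind : _ => // [x y|i _].
  by rewrite ge_max => -> ->.
by elim/big_ind : _ => // x y; rewrite ge_max => -> ->.
Qed.

(** The bound on products is stated separately because the network sees the kernel only through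
    [conj (K i j) * K i' j], and it is sharper than what the entrywise bound would give. *)
Lemma low_rank_kernel (omega1 omega2 : R) (ntheta nrho r nr : nat)
    (nr_ntheta : (nr %| ntheta)%N) (nr_nrho : (nr %| nrho)%N) :
  0 < omega1 -> 0 < omega2 -> (0 < ntheta)%N -> (0 < nrho)%N ->
  (0 < r)%N -> (0 < nr)%N ->
  let K := Kmx omega1 omega2 ntheta nrho in
  let eps := (pi / 2 * omega2) ^+ r / r`!%:R / nr%:R ^+ (2 * r) in
  exists Kr : 'M[R[i]]_(ntheta, nrho),
  [/\ forall a b : 'I_nr, (\rank (block nr_ntheta nr_nrho Kr a b) <= r)%N,
      forall i j, cmod (K i j - Kr i j) <= eps &
      forall i i' j, cmod ((K i j)^*%C * K i' j - (Kr i j)^*%C * Kr i' j) <= 2 * eps].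
Proof.
move=> w10 w20 nt0 nrho0 r0 nr0 K eps.
have nr0' : 0 < nr%:R :> R by rewrite ltr0n.
pose X : R := pi / 2 * omega2 / nr%:R ^+ 2.
have X0 : 0 <= X by rewrite !mulr_ge0 ?invr_ge0 ?exprn_ge0 ?pi_ge0// ltW.
have XE : X ^+ r / r`!%:R = eps.
  by rewrite /X /eps expr_div_n -exprM mulrAC.
have [c] := expi_poly_approx r0 X0; rewrite XE.
set P := (fun x => _) => -[hP hPP].
pose s j : R := j.+1%:R / nrho%:R; pose s0 j := block_center nrho nr j.
pose t i := cos (theta ntheta i : R); pose t0 i := cos (2 * pi * block_center ntheta nr i).
(* From [s t = s0 (t - t0) + s t0 + (s - s0) (t - t0)]: on a block, where [s0] and [t0] are
   constant, the first two terms depend on one index each and form the unimodular factor [U]. Only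
   the last one needs approximation. *)
pose x i j := - (omega2 * (s j - s0 j)) * (t i - t0 i).
pose U i j := expi (- (omega2 * s0 j * (t i - t0 i))) * expi (- (omega2 * s j * t0 i)).
have hx i j : `|x i j| <= X.
  rewrite /x mulNr normrN !normrM (gtr0_norm w20).
  have h1 : `|s j - s0 j| <= 2^-1 / nr%:R by exact: block_center_dist.
  have h2 : `|t i - t0 i| <= 2 * pi * (2^-1 / nr%:R).
    apply: (le_trans (cos_lipschitz _ _)); rewrite /theta -mulrA -mulrBr normrM.
    by rewrite ger0_norm ?mulr_ge0 ?pi_ge0// ler_wpM2l ?mulr_ge0 ?pi_ge0// block_center_dist.
  (* Half a block is [1 / (2 nr)] in the radial variable and [pi / nr] in the angle. *)
  have -> : X = omega2 * (2^-1 / nr%:R) * (2 * pi * (2^-1 / nr%:R)).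
    by rewrite /X; field; rewrite gt_eqF.
  by rewrite -mulrA -[leRHS]mulrA ler_pM2l//; apply: ler_pM.
have KE i j : K i j = U i j * expi (x i j).
  rewrite /K mxE /kernel /U -!expiD; congr expi; rewrite /Defs.radius /x /s /t.
  by set A := cos _; set B := _ / nrho%:R; field; rewrite gt_eqF.
have cU i j : cmod (U i j) = 1 by rewrite cmodM !cmod_expi mulr1.
pose Kr : 'M[R[i]]_(ntheta, nrho) := \matrix_(i, j) (U i j * P (x i j)).
exists Kr; split.
- move=> a b.
  pose i0 : nat := (a * (ntheta %/ nr))%N; pose j0 := (b * (nrho %/ nr))%N.
  have hi (n : nat) (d : (nr %| n)%N) (e : 'I_nr) (i : 'I_(n %/ nr)) :
      block_center n nr (block_index d e i) = block_center n nr (e * (n %/ nr))%N.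
    rewrite /block_center /=; congr ((_%:R + _) / _).
    have q0 : (0 < n %/ nr)%N by apply: leq_ltn_trans (ltn_ord i).
    by rewrite divnMDl// mulnK// divn_small ?addn0.
  (* With the centre fixed, [x ^ k] is a row factor times a column factor, so the block factors
     through dimension [r]. *)
  pose A : 'M[R[i]]_(ntheta %/ nr, r) := \matrix_(i, k)
    (expi (- (omega2 * s0 j0 * (t (block_index nr_ntheta a i) - t0 i0))) * c k *
     ((t (block_index nr_ntheta a i) - t0 i0) ^+ k)%:C).
  pose B : 'M[R[i]]_(r, nrho %/ nr) := \matrix_(k, j)
    (expi (- (omega2 * s (block_index nr_nrho b j) * t0 i0)) *
     ((- (omega2 * (s (block_index nr_nrho b j) - s0 j0))) ^+ k)%:C).
  suff -> : block nr_ntheta nr_nrho Kr a b = A *m B by exact: mulmx_max_rank.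
  apply/matrixP => i j; rewrite !mxE /U /P mulr_sumr; apply: eq_bigr => k _.
  rewrite !mxE /x /s0 /t0 !hi exprMn real_complexM -/(s0 j0) -/(t0 i0).
  by ring.
- by move=> i j; rewrite KE [Kr i j]mxE -mulrBr cmodM cU mul1r hP.
- move=> i i' j; rewrite [Kr _ _]mxE [Kr i' _]mxE !KE.
  have -> : (U i j * expi (x i j))^*%C * (U i' j * expi (x i' j)) -
    (U i j * P (x i j))^*%C * (U i' j * P (x i' j)) =
    (U i j)^*%C * U i' j * ((expi (x i j))^*%C * expi (x i' j) - (P (x i j))^*%C * P (x i' j)).
    by rewrite !conjcM; ring.
  by rewrite cmodM [cmod (_ * U _ _)]cmodM cmod_conj !cU !mul1r hPP.
Qed.

End LowRankKernel.

(** * Complex-valued integrals on the plane *)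

Section ComplexIntegral.
Local Open Scope classical_set_scope.
Context {R : realType}.
Notation mu := (@plane_measure R).
Implicit Types (D : set (R * R)) (f g : R * R -> R[i]) (h : R * R -> R).

Definition cmeasurable D f :=
  measurable_fun D (fun y => complex.Re (f y)) /\
  measurable_fun D (fun y => complex.Im (f y)).

Definition cintegrable D f :=
  mu.-integrable D (EFin \o (fun y => complex.Re (f y))) /\
  mu.-integrable D (EFin \o (fun y => complex.Im (f y))).

Lemma cmeasurable_cmod D f : cmeasurable D f -> measurable_fun D (fun y => cmod (f y)).
Proof.
move=> [mr mi]; rewrite (_ : (fun y => _) =
    @Num.sqrt R \o (fun y => complex.Re (f y) ^+ 2 + complex.Im (f y) ^+ 2)); last first.
  by apply/funext => y /=; case: (f y).
apply: measurableT_comp; last by apply: measurable_funD; exact: measurable_funX.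
by apply: continuous_measurable_fun; exact: sqrt_continuous.
Qed.

Lemma cmeasurableM D f g : cmeasurable D f -> cmeasurable D g ->
  cmeasurable D (fun y => f y * g y).
Proof.
move=> [fr fi] [gr gi]; split.
  rewrite (_ : (fun y => _) = fun y => complex.Re (f y) * complex.Re (g y) -
    complex.Im (f y) * complex.Im (g y)).
    by apply: measurable_funB; exact: measurable_funM.
  by apply/funext => y; case: (f y) (g y) => [a b] [c d].
rewrite (_ : (fun y => _) = fun y => complex.Re (f y) * complex.Im (g y) +
    complex.Im (f y) * complex.Re (g y)).
  by apply: measurable_funD; exact: measurable_funM.
by apply/funext => y; case: (f y) (g y) => [a b] [c d].
Qed.

Lemma cmeasurableD D f g : cmeasurable D f -> cmeasurable D g ->
  cmeasurable D (fun y => f y + g y).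
Proof.
move=> [fr fi] [gr gi]; split.
  rewrite (_ : (fun y => _) = fun y => complex.Re (f y) + complex.Re (g y)).
    exact: measurable_funD.
  by apply/funext => y; case: (f y) (g y) => [a b] [c d].
rewrite (_ : (fun y => _) = fun y => complex.Im (f y) + complex.Im (g y)).
  exact: measurable_funD.
by apply/funext => y; case: (f y) (g y) => [a b] [c d].
Qed.

Lemma cmeasurable_cst D (z : R[i]) : cmeasurable D (fun=> z).
Proof. by split; exact: measurable_cst. Qed.

Lemma cmeasurable_expi D h : measurable_fun D h -> cmeasurable D (fun y => expi (h y)).
Proof.
move=> mh; split => /=.
  by apply: measurableT_comp mh; apply: continuous_measurable_fun; exact: continuous_cos.
by apply: measurableT_comp mh; apply: continuous_measurable_fun; exact: continuous_sin.
Qed.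

Lemma cintegrable_le D f h : measurable D -> cmeasurable D f ->
  mu.-integrable D (EFin \o h) -> (forall y, D y -> cmod (f y) <= h y) ->
  cintegrable D f.
Proof.
move=> mD [fr fi] ih fh.
split.
  apply: (@le_integrable _ _ _ mu D mD _ (EFin \o h)) => //; first exact/measurable_EFinP.
  move=> y Dy /=; rewrite lee_fin (le_trans _ (ler_norm (h y)))//.
  by apply: le_trans (fh _ Dy); exact: normr_Re_le.
apply: (@le_integrable _ _ _ mu D mD _ (EFin \o h)) => //; first exact/measurable_EFinP.
move=> y Dy /=; rewrite lee_fin (le_trans _ (ler_norm (h y)))//.
by apply: le_trans (fh _ Dy); exact: normr_Im_le.
Qed.

Lemma cintegralB D f g : measurable D -> cintegrable D f -> cintegrable D g ->
  cintegral D (fun y => f y - g y) = cintegral D f - cintegral D g.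
Proof.
move=> mD [fr fi] [gr gi]; rewrite /cintegral.
apply/eqP; rewrite eq_complex /=; apply/andP; split; apply/eqP.
  rewrite -RintegralB//; apply: eq_Rintegral => y _.
  by case: (f y) (g y) => [a b] [c d].
rewrite -RintegralB//; apply: eq_Rintegral => y _.
by case: (f y) (g y) => [a b] [c d].
Qed.

(** Reduces statements about complex integrals to real ones: [z = - i] extracts imaginary parts, and
    [z] the conjugate of the integral gives its squared modulus. *)
Lemma cintegrable_ReM D f (z : R[i]) : measurable D -> cintegrable D f ->
  mu.-integrable D (EFin \o (fun y => complex.Re (z * f y))) /\
  \int[mu]_(y in D) complex.Re (z * f y) = complex.Re (z * cintegral D f).
Proof.
move=> mD [fr fi]; have e y : complex.Re (z * f y) =
    complex.Re z * complex.Re (f y) - complex.Im z * complex.Im (f y).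
  by case: z (f y) => [a b] [c d].
have ir : mu.-integrable D (EFin \o (fun y => complex.Re z * complex.Re (f y))).
  exact: (@integrableZl _ _ _ mu D mD (complex.Re z) _ fr).
have ii : mu.-integrable D (EFin \o (fun y => complex.Im z * complex.Im (f y))).
  exact: (@integrableZl _ _ _ mu D mD (complex.Im z) _ fi).
split.
  apply: (@eq_integrable _ _ _ mu D mD _ _ _ (@integrableB _ _ _ mu D mD _ _ ir ii)) => y _ /=.
  by rewrite e EFinB.
under eq_Rintegral do rewrite e.
rewrite RintegralB// !RintegralZl// /cintegral.
by case: z {e ir ii}.
Qed.

Lemma cintegralZ D f (z : R[i]) : measurable D -> cintegrable D f ->
  cintegral D (fun y => z * f y) = z * cintegral D f.
Proof.
move=> mD fi; apply/eqP; rewrite eq_complex; apply/andP; split; apply/eqP.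
  by have [_ <-] := cintegrable_ReM z mD fi.
have imE (w : R[i]) : complex.Im w = complex.Re (- 'i%C * w).
  by case: w => a b /=; ring.
rewrite [RHS]imE mulrA; have [_ <-] := cintegrable_ReM (- 'i%C * z) mD fi.
by apply: eq_Rintegral => y _; rewrite imE mulrA.
Qed.

(** With [z] the integral of [f], [|z| ^ 2] is the integral of the real part of [conj z * f], which
    is at most [|z|] times the integral of [h]. It remains to divide by [|z|] when this is
    nonzero. *)
Lemma cmod_cintegral_le D f h : measurable D -> cintegrable D f ->
  mu.-integrable D (EFin \o h) -> (forall y, D y -> cmod (f y) <= h y) ->
  cmod (cintegral D f) <= \int[mu]_(y in D) h y.
Proof.
move=> mD fi ih fh; set z := cintegral D f.
have [iz] := cintegrable_ReM (z^*%C) mD fi; rewrite -/z conjM_cmod => zE.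
have ihz : mu.-integrable D (EFin \o (fun y => cmod z * h y)).
  exact: (@integrableZl _ _ _ mu D mD (cmod z) _ ih).
have : \int[mu]_(y in D) complex.Re (z^*%C * f y) <= \int[mu]_(y in D) (cmod z * h y).
  apply: le_Rintegral => // y Dy; apply: (le_trans (Re_le_cmod _)).
  by rewrite cmodM cmod_conj ler_wpM2l ?cmod_ge0// fh.
rewrite zE RintegralZl//.
rewrite (_ : complex.Re (cmod z ^+ 2)%:C = cmod z * cmod z); last by rewrite -expr2.
have [->|zn0] := eqVneq (cmod z) 0.
  by move=> _; apply: Rintegral_ge0 => y Dy; apply: le_trans (fh _ Dy); exact: cmod_ge0.
by rewrite ler_pM2l// lt_neqAle eq_sym zn0 cmod_ge0.
Qed.

End ComplexIntegral.

(** * The unit disc and its essentially bounded functions *)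

Section UnitDisc.
Local Open Scope classical_set_scope.
Context {R : realType}.
Notation mu := (@plane_measure R).
Notation disc := (@unit_disc R).
Implicit Types (D : set (R * R)) (f g : R * R -> R[i]) (v : R * R).

Lemma measurable_dot v D : measurable_fun D (dot v).
Proof.
apply: measurable_funTS; apply: measurable_funD; apply: measurable_funM => //.
Qed.

Lemma measurable_unit_disc : measurable disc.
Proof.
have mf : measurable_fun setT (fun y : R * R => dot y y).
  by apply: measurable_funD; apply: measurable_funM.
have := mf measurableT `]-oo, 1%R] (measurable_itv _).
by rewrite setTI (_ : _ @^-1` _ = disc).
Qed.

Lemma plane_measureX (a b c d : R) : (a <= b)%R -> (c <= d)%R ->
  mu ([set` `[a, b[%R] `*` [set` `[c, d[%R]) = ((b - a) * (d - c))%:E.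
Proof.
move=> ab cd.
have h (x y : R) : x <= y -> lebesgue_measure [set` `[x, y[%R] = (y - x)%:E.
  move=> xy; rewrite lebesgue_measure_itv /= lte_fin; case: ltP => // yx.
  by have -> : x = y; [apply/eqP; rewrite eq_le xy|rewrite subrr].
rewrite /plane_measure [LHS]product_measure1E; [|exact: measurable_itv..].
by rewrite [X in (X * _)%E](h _ _ ab) [X in (_ * X)%E](h _ _ cd).
Qed.

Lemma unit_disc_lty : (mu disc < +oo)%E.
Proof.
apply: (@le_lt_trans _ _ (mu ([set` `[(-1)%R, 2%R[%R] `*` [set` `[(-1)%R, 2%R[%R]))).
  apply: le_measure; rewrite ?inE; [exact: measurable_unit_disc|exact: measurableX|].
  move=> [a b]; rewrite /unit_disc /dot /= !in_itv/= => h.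
  have a2 : a ^+ 2 <= 1 by apply: le_trans h; rewrite -!expr2 lerDl sqr_ge0.
  have b2 : b ^+ 2 <= 1 by apply: le_trans h; rewrite -!expr2 lerDr sqr_ge0.
  by split; apply/andP; split; nra.
by rewrite plane_measureX ?ltry//; lra.
Qed.

(** An essentially bounded function is dominated almost everywhere by a constant, which is
    integrable on a set of finite measure. *)
Lemma disc_Linfty_integrable f : disc_Linfty f ->
  mu.-integrable disc (EFin \o (fun y => cmod (f y))).
Proof.
move=> [fr fi foo].
have mc : measurable_fun disc (fun y => cmod (f y)) by exact: cmeasurable_cmod.
(* The norm of exponent [+oo] is the essential supremum only on a space of positive measure. *)
have mT : (0 < mu [set: R * R])%E.
  apply: (@lt_le_trans _ _ (mu ([set` `[0%R, 1%R[%R] `*` [set` `[0%R, 1%R[%R]))).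
    by rewrite plane_measureX// subr0 mulr1 lte_fin.
  by apply: le_measure; rewrite ?inE//; exact: measurableX.
pose g : R * R -> \bar R := (fun y => (cmod (f y))%:E) \_ disc.
move: foo; rewrite /disc_Lnorm unlock mT -/g => foo.
(* The essential supremum is an extended real below [+oo]: a real [x] gives [M = |x|], and the
   formal value [-oo] gives [M = 0]. *)
have [M M0 hM] : exists2 M : R, 0 <= M & \forall y \ae mu, (`|g y| <= M%:E)%E.
  have := @ess_sup_ge _ _ _ mu (abse \o g).
  case: (ess_sup mu (abse \o g)) foo => [x _|//|_] h.
    exists `|x| => //; case: h => N [mN muN sN]; exists N; split => //.
    apply: subset_trans sN => y; apply: contra_not => /= hy.
    by apply: (le_trans hy); rewrite lee_fin ler_norm.
  exists 0 => //; case: h => N [mN muN sN]; exists N; split => //.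
  apply: subset_trans sN => y; apply: contra_not => /= hy.
  by rewrite (le_trans hy) ?leNye.
apply/integrableP; split; first exact/measurable_EFinP.
apply: (@le_lt_trans _ _ (\int[mu]_(y in disc) (M%:E))%E).
  apply: ae_ge0_le_integral => //.
  - exact: measurable_unit_disc.
  - by apply: measurableT_comp => //; exact/measurable_EFinP.
  - case: hM => N [mN muN sN]; exists N; split => //.
    apply: subset_trans sN => y; apply: contra_not => /= hy Dy.
    by move: hy; rewrite /g patchE mem_set.
rewrite integral_cst//; last exact: measurable_unit_disc.
by rewrite lte_mul_pinfty// unit_disc_lty.
Qed.

Lemma disc_L1normE f : disc_L1norm f = \int[mu]_(y in disc) cmod (f y).
Proof.
rewrite /disc_L1norm /disc_Lnorm Lnorm1 /Rintegral; congr fine.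
rewrite [RHS]integral_mkcond; apply: eq_integral => y _.
by rewrite !patchE; case: ifPn => _; rewrite ?abse0// gee0_abs// lee_fin cmod_ge0.
Qed.

Lemma disc_L1norm_ge0 f : 0 <= disc_L1norm f.
Proof. by rewrite disc_L1normE Rintegral_ge0// => y _; exact: cmod_ge0. Qed.

End UnitDisc.

(** * Oscillatory integrals over the disc *)

Section OscillatoryIntegral.
Local Open Scope classical_set_scope.
Context {R : realType}.
Notation mu := (@plane_measure R).
Notation disc := (@unit_disc R).
Variables (gamma eta : R * R -> R[i]).
Hypotheses (gammaP : disc_Linfty gamma) (etaP : disc_Linfty eta).
Implicit Types (h : R * R -> R) (a b z : R[i]).

(** Common form, up to the factor [coef omega], of the data and of the integrand of the adjoint:
    both differ only in the phase [h] and the weights [a], [b] of [eta] and [gamma]. *)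
Definition osc h a b : R[i] :=
  cintegral disc (fun y => expi (h y) * (a * eta y + b * gamma y)).

Let N : R := disc_L1norm eta + disc_L1norm gamma.

Let mdisc : measurable disc := @measurable_unit_disc R.

Let weight_integrable (s t : R) :
  mu.-integrable disc (EFin \o (fun y => s * cmod (eta y) + t * cmod (gamma y))).
Proof.
have i1 := @integrableZl _ _ _ mu disc mdisc s _ (disc_Linfty_integrable etaP).
have i2 := @integrableZl _ _ _ mu disc mdisc t _ (disc_Linfty_integrable gammaP).
exact: (@integrableD _ _ _ mu disc mdisc _ _ i1 i2).
Qed.

Let weight_integral (s t : R) :
  \int[mu]_(y in disc) (s * cmod (eta y) + t * cmod (gamma y)) =
  s * disc_L1norm eta + t * disc_L1norm gamma.
Proof.
have i1 := @integrableZl _ _ _ mu disc mdisc s _ (disc_Linfty_integrable etaP).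
have i2 := @integrableZl _ _ _ mu disc mdisc t _ (disc_Linfty_integrable gammaP).
rewrite (@RintegralD _ _ _ mu disc _ _ mdisc i1 i2).
rewrite (@RintegralZl _ _ _ mu disc _ s mdisc (disc_Linfty_integrable etaP)).
rewrite (@RintegralZl _ _ _ mu disc _ t mdisc (disc_Linfty_integrable gammaP)).
by rewrite !disc_L1normE.
Qed.

Let cmod_comb a b y :
  cmod (a * eta y + b * gamma y) <= cmod a * cmod (eta y) + cmod b * cmod (gamma y).
Proof. by apply: (le_trans (cmodD _ _)); rewrite !cmodM. Qed.

Lemma osc_integrable h a b : measurable_fun disc h ->
  cintegrable disc (fun y => expi (h y) * (a * eta y + b * gamma y)).
Proof.
move=> mh; apply: (cintegrable_le mdisc _ (weight_integrable (cmod a) (cmod b))).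
  apply: cmeasurableM; first exact: cmeasurable_expi.
  have [? ? _] := gammaP; have [? ? _] := etaP.
  by apply: cmeasurableD; apply: cmeasurableM => //; exact: cmeasurable_cst.
by move=> y _; rewrite cmodM cmod_expi mul1r cmod_comb.
Qed.

Lemma osc_le h a b : measurable_fun disc h -> cmod a <= 1 -> cmod b <= 1 ->
  cmod (osc h a b) <= N.
Proof.
move=> mh a1 b1; have -> : N = 1 * disc_L1norm eta + 1 * disc_L1norm gamma by rewrite !mul1r.
rewrite -weight_integral; apply: (cmod_cintegral_le mdisc _ (weight_integrable 1 1)).
  exact: osc_integrable.
move=> y _; rewrite cmodM cmod_expi mul1r (le_trans (cmod_comb _ _ _))//.
by apply: lerD; rewrite ler_wpM2r ?cmod_ge0.
Qed.

(** The difference of the integrands splits into a change of phase at fixed weights, costing [d],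
    and a change of weights at fixed phase, costing [e]. *)
Lemma osc_lipschitz h h' a b a' b' (d e : R) :
  measurable_fun disc h -> measurable_fun disc h' ->
  cmod a <= 1 -> cmod b <= 1 ->
  cmod (a - a') <= e -> cmod (b - b') <= e ->
  (forall y, disc y -> `|h y - h' y| <= d) ->
  cmod (osc h a b - osc h' a' b') <= (d + e) * N.
Proof.
move=> mh mh' a1 b1 aa' bb' hh'.
rewrite /osc -cintegralB//; [|exact: osc_integrable..].
rewrite /N mulrDr -weight_integral.
apply: (cmod_cintegral_le mdisc _ (weight_integrable (d + e) (d + e))).
  have [i1 i2] := osc_integrable a b mh.
  have [j1 j2] := osc_integrable a' b' mh'.
  have k1 := @integrableB _ _ _ mu disc mdisc _ _ i1 j1.
  have k2 := @integrableB _ _ _ mu disc mdisc _ _ i2 j2.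
  split.
    apply: (@eq_integrable _ _ _ mu disc mdisc _ _ _ k1) => y _.
    by rewrite [RHS]/= ReB EFinB.
  apply: (@eq_integrable _ _ _ mu disc mdisc _ _ _ k2) => y _.
  by rewrite [RHS]/= ImB EFinB.
move=> y Dy.
have -> : expi (h y) * (a * eta y + b * gamma y) - expi (h' y) * (a' * eta y + b' * gamma y)
  = (expi (h y) - expi (h' y)) * (a * eta y + b * gamma y)
    + expi (h' y) * ((a - a') * eta y + (b - b') * gamma y) by ring.
apply: (le_trans (cmodD _ _)); rewrite [cmod (expi (h' y) * _)]cmodM cmod_expi mul1r cmodM.
have eg := cmod_ge0 (eta y); have gg := cmod_ge0 (gamma y).
have e1 : cmod (expi (h y) - expi (h' y)) <= d by apply: (le_trans (cmod_expiB _ _)); exact: hh'.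
have e2 : cmod (a * eta y + b * gamma y) <= cmod (eta y) + cmod (gamma y).
  by apply: (le_trans (cmod_comb _ _ _)); apply: lerD; rewrite -[leRHS]mul1r ler_wpM2r.
have e3 : cmod ((a - a') * eta y + (b - b') * gamma y) <= e * cmod (eta y) + e * cmod (gamma y).
  by apply: (le_trans (cmod_comb _ _ _)); apply: lerD; rewrite ler_wpM2r.
have := ler_pM (cmod_ge0 _) (cmod_ge0 _) e1 e2; move: e3.
move: (cmod (_ + _)) (_ * cmod (_ + _)) => u v; lra.
Qed.

(** Lets the oscillating factor of the adjoint enter the phase of the data and the power of the
    cosine enter the weights. *)
Lemma mul_osc z (s : R) h a b : measurable_fun disc h ->
  z * expi s * osc h a b = osc (fun y => s + h y) (z * a) (z * b).
Proof.
move=> mh; rewrite /osc -cintegralZ//; last exact: osc_integrable.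
congr cintegral; apply/funext => y.
rewrite expiD; move: (eta y) (gamma y) (expi s) (expi (h y)) => ? ? ? ?; ring.
Qed.

Definition phase omega (x zeta y : R * R) : R := omega * dot (zeta - x) y.

Lemma measurable_phase omega x zeta : measurable_fun disc (phase omega x zeta).
Proof. by apply: measurable_funM => //; exact: measurable_dot. Qed.

Lemma Frow_osc omega x zeta : Frow omega gamma eta x zeta =
  coef omega * osc (phase omega x zeta) 1 (- (dot x zeta)%:C).
Proof.
rewrite /Frow /F1 /F2 mulNr addrC -mulrBr -cintegralB//; last first.
- have := osc_integrable 0 (dot x zeta)%:C (measurable_phase omega x zeta).
  congr cintegrable; apply/funext => y; rewrite mul0r add0r /phase; ring.
- have := osc_integrable 1 0 (measurable_phase omega x zeta).
  by congr cintegrable; apply/funext => y; rewrite mul0r addr0 mul1r.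
congr (_ * cintegral _ _); apply/funext => y; rewrite /phase; ring.
Qed.

End OscillatoryIntegral.

(** * Lipschitz estimates for points of the circle *)

Section CirclePoints.
Local Open Scope classical_set_scope.
Context {R : realType}.
Implicit Types (s t : R) (u v w : R * R).

(** Makes the Euclidean length of a plane vector a complex modulus. *)
Definition pt_complex w : R[i] := w.1 +i* w.2.

(** Cauchy-Schwarz, since [dot u w] is the real part of [u * conj w]. *)
Lemma dot_le u w : `|dot u w| <= cmod (pt_complex u) * cmod (pt_complex w).
Proof.
have <- : complex.Re (pt_complex u * (pt_complex w)^*%C) = dot u w.
  by rewrite /dot /= mulrN opprK.
rewrite -(cmod_conj (pt_complex w)) -cmodM; move: (_ * _) => [a b] /=.
by rewrite -sqrtr_sqr ler_wsqrtr// lerDl sqr_ge0.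
Qed.

Lemma dot_circle s t : dot (circle_pt s) (circle_pt t) = cos (s - t).
Proof. by rewrite /dot /circle_pt /polar /= !mul1r cosB. Qed.

(** The double-angle formula gives the constant 1, where factoring the difference of squares would
    give 2. *)
Lemma cos2_lipschitz s t : `|cos s ^+ 2 - cos t ^+ 2| <= `|s - t|.
Proof.
have e (a : R) : cos a ^+ 2 = (1 + cos (a + a)) / 2.
  by have := cos2Dsin2 a; rewrite cosD; lra.
rewrite !e; have := cos_lipschitz (s + s) (t + t).
have -> : (1 + cos (s + s)) / 2 - (1 + cos (t + t)) / 2 =
    2^-1 * (cos (s + s) - cos (t + t)) by field.
have -> : s + s - (t + t) = 2 * (s - t) by ring.
rewrite !normrM (@ger0_norm _ 2)// (@ger0_norm _ 2^-1)//; lra.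
Qed.

Lemma pt_circleB s t : pt_complex (circle_pt s - circle_pt t) = expi s - expi t.
Proof. by rewrite /pt_complex /circle_pt /polar /= !mul1r. Qed.

Lemma cmod_unit_disc w : unit_disc w -> cmod (pt_complex w) <= 1.
Proof.
rewrite /unit_disc /dot /= -!expr2 => h.
by rewrite -sqrtr1 ler_wsqrtr.
Qed.

(** Regrouped by variable, the difference involves two chords, each no longer than its arc, paired
    with [u - v] of length at most 2. *)
Lemma dot_circle_lipschitz s t s' t' u v : unit_disc u -> unit_disc v ->
  `|dot (circle_pt s - circle_pt t) (u - v) -
    dot (circle_pt s' - circle_pt t') (u - v)| <= 2 * (`|s - s'| + `|t - t'|).
Proof.
move=> Du Dv.
have -> : dot (circle_pt s - circle_pt t) (u - v) - dot (circle_pt s' - circle_pt t') (u - v)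
   = dot (circle_pt s - circle_pt s') (u - v) - dot (circle_pt t - circle_pt t') (u - v).
  by rewrite /dot /=; ring.
have h a b : `|dot (circle_pt a - circle_pt b) (u - v)| <= 2 * `|a - b|.
  apply: (le_trans (dot_le _ _)); rewrite mulrC pt_circleB.
  apply: ler_pM; rewrite ?cmod_ge0 ?cmod_expiB//.
  have -> : pt_complex (u - v) = pt_complex u - pt_complex v by [].
  apply: (le_trans (cmodD _ _)); rewrite cmodN.
  by have := cmod_unit_disc Du; have := cmod_unit_disc Dv; lra.
apply: (le_trans (ler_normB _ _)).
by have := h s s'; have := h t t'; lra.
Qed.

End CirclePoints.

(** * Sums and indicator functions under the complex integral *)

Section ComplexIntegralSum.
Local Open Scope classical_set_scope.
Context {R : realType}.
Notation mu := (@plane_measure R).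
Implicit Types (D : set (R * R)) (f g : R * R -> R[i]).

Lemma integrable_cst_lty D (c : R) : measurable D -> (mu D < +oo)%E ->
  mu.-integrable D (EFin \o (fun=> c)).
Proof.
move=> mD Doo; apply/integrableP; split; first exact/measurable_EFinP.
rewrite /comp /= integral_cst//.
by rewrite lte_mul_pinfty.
Qed.

Lemma cintegrable0 D : measurable D -> cintegrable D (fun=> 0).
Proof.
move=> mD; split.
  by apply: (@eq_integrable _ _ _ mu D mD _ _ _ (@integrable0 _ _ _ mu D)).
by apply: (@eq_integrable _ _ _ mu D mD _ _ _ (@integrable0 _ _ _ mu D)).
Qed.

Lemma cintegral0 D : cintegral D (fun=> 0) = 0 :> R[i].
Proof. by rewrite /cintegral /Rintegral /= integral0. Qed.

Lemma cintegrableD D f g : measurable D -> cintegrable D f -> cintegrable D g ->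
  cintegrable D (fun y => f y + g y).
Proof.
move=> mD [fr fi] [gr gi].
have ir := @integrableD _ _ _ mu D mD _ _ fr gr.
have ii := @integrableD _ _ _ mu D mD _ _ fi gi.
split.
  apply: (@eq_integrable _ _ _ mu D mD _ _ _ ir) => y _.
  by rewrite /comp -EFinD; case: (f y) (g y) => [? ?] [? ?].
apply: (@eq_integrable _ _ _ mu D mD _ _ _ ii) => y _.
by rewrite /comp -EFinD; case: (f y) (g y) => [? ?] [? ?].
Qed.

Lemma cintegralD D f g : measurable D -> cintegrable D f -> cintegrable D g ->
  cintegral D (fun y => f y + g y) = cintegral D f + cintegral D g.
Proof.
move=> mD [fr fi] [gr gi]; rewrite /cintegral.
apply/eqP; rewrite eq_complex /=; apply/andP; split; apply/eqP.
  rewrite -RintegralD//; apply: eq_Rintegral => y _.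
  by case: (f y) (g y) => [a b] [c d].
rewrite -RintegralD//; apply: eq_Rintegral => y _.
by case: (f y) (g y) => [a b] [c d].
Qed.

Lemma cintegral_sum (I : Type) (s : seq I) D (F : I -> R * R -> R[i]) :
  measurable D -> (forall i, cintegrable D (F i)) ->
  cintegrable D (fun y => \sum_(i <- s) F i y) /\
  cintegral D (fun y => \sum_(i <- s) F i y) = \sum_(i <- s) cintegral D (F i).
Proof.
move=> mD iF; elim: s => [|i s [IH1 IH2]].
  have e : (fun y => \sum_(i <- [::]) F i y) = fun=> 0.
    by apply/funext => y; rewrite big_nil.
  by rewrite e big_nil cintegral0; split => //; exact: cintegrable0.
have e : (fun y => \sum_(j <- i :: s) F j y) = fun y => F i y + \sum_(j <- s) F j y.
  by apply/funext => y; rewrite big_cons.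
by rewrite e big_cons cintegralD// IH2; split => //; exact: cintegrableD.
Qed.

Lemma cintegral_indic D E (z : R[i]) : measurable D -> measurable E ->
  E `<=` D -> (mu D < +oo)%E ->
  cintegrable D (fun y => z * (\1_E y)%:C) /\
  cintegral D (fun y => z * (\1_E y)%:C) = z * (fine (mu E))%:C.
Proof.
move=> mD mE ED Doo.
have ie : cintegrable D (fun y => (\1_E y)%:C).
  split; last by have [] := cintegrable0 mD.
  apply: (@le_integrable _ _ _ mu D mD _ _ _ _ (integrable_cst_lty 1 mD Doo)).
    by apply/measurable_EFinP; exact: measurable_indic.
  by move=> y _; rewrite /= lee_fin indicE normr1; case: (_ \in _); rewrite ?normr1 ?normr0.
split; last first.
  rewrite cintegralZ//; congr (_ * _).
  rewrite /cintegral /= {2}/Rintegral integral0.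
  by rewrite /Rintegral integral_indic// setIidl.
have mz : cmeasurable D (fun y => z * (\1_E y)%:C).
  apply: cmeasurableM; first exact: cmeasurable_cst.
  by split; [exact: measurable_indic|exact: measurable_cst].
apply: (cintegrable_le mD mz (integrable_cst_lty (cmod z) mD Doo)) => y _.
rewrite cmodM cmodR indicE; case: (_ \in _).
  by rewrite normr1 mulr1.
by rewrite normr0 mulr0 cmod_ge0.
Qed.

End ComplexIntegralSum.

(** * Quadrature on the torus *)

Section TorusQuadrature.
Local Open Scope classical_set_scope.
Context {R : realType}.
Notation mu := (@plane_measure R).
Variable C : R.
Variable G : R * R -> R[i].
Hypothesis G_lipschitz : forall a b, cmod (G a - G b) <= C * (`|a.1 - b.1| + `|a.2 - b.2|).

Definition torus : set (R * R) := [set` `[0, 2 * pi[%R] `*` [set` `[0, 2 * pi[%R].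

Let pi0 : 0 < 2 * pi :> R. Proof. by rewrite mulr_gt0// pi_gt0. Qed.

Let C0 : 0 <= C.
Proof.
have := G_lipschitz (1, 0) (0, 0); rewrite /= !subr0 normr1 normr0 addr0 mulr1.
by apply: le_trans; exact: cmod_ge0.
Qed.

Lemma measurable_torus : measurable torus.
Proof. exact: measurableX. Qed.

Lemma torus_measure : mu torus = ((2 * pi) ^+ 2)%:E.
Proof. by rewrite plane_measureX ?ltW// !subr0 expr2. Qed.

Lemma torus_lty : (mu torus < +oo)%E.
Proof. by rewrite torus_measure ltry. Qed.

Section Step.
Variable n : nat.
Hypothesis n0 : (0 < n)%N.

Let h : R := 2 * pi / n%:R.

Let n0' : 0 < n%:R :> R. Proof. by rewrite ltr0n. Qed.

Let h0 : 0 < h. Proof. by rewrite divr_gt0. Qed.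

Definition cell (k : 'I_n * 'I_n) : set (R * R) :=
  [set` `[h * k.1%:R, h * k.1.+1%:R[%R] `*` [set` `[h * k.2%:R, h * k.2.+1%:R[%R].

(** Grid indices start at 1, so the node of a half-open cell is its upper right corner, which lies
    outside the cell but within [h] of it in each coordinate. *)
Definition step_approx (a : R * R) : R[i] :=
  \sum_(k : 'I_n * 'I_n) G (theta n k.1, theta n k.2) * (\1_(cell k) a)%:C.

Lemma measurable_cell k : measurable (cell k).
Proof. exact: measurableX. Qed.

Lemma cell_measure k : mu (cell k) = (h ^+ 2)%:E.
Proof.
rewrite plane_measureX ?ler_pM2l ?ler_nat//; congr EFin.
by rewrite -!mulrBr -!natrB// !subSnn !mulr1 expr2.
Qed.

Lemma cell_torus k : cell k `<=` torus.
Proof.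
have hn (i : 'I_n) x : h * i%:R <= x < h * i.+1%:R -> 0 <= x < 2 * pi.
  move=> /andP[x1 x2]; apply/andP; split.
    by apply: le_trans x1; rewrite mulr_ge0// ltW.
  apply: (lt_le_trans x2); rewrite (_ : 2 * pi = h * n%:R).
    by rewrite ler_pM2l// ler_nat.
  by rewrite /h divfK// gt_eqF.
move=> [a b] []; rewrite /= !in_itv/= => /hn ? /hn ?.
by split; rewrite /= in_itv/=.
Qed.

(** The index is the integer part of [x / h]. The boolean equality gives existence and uniqueness at
    once. *)
Let cell_index x : 0 <= x < 2 * pi ->
  exists i : 'I_n, forall j : 'I_n, (h * j%:R <= x < h * j.+1%:R) = (j == i).
Proof.
move=> /andP[x0 xpi]; have xh0 : 0 <= x / h by rewrite divr_ge0// ltW.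
have /andP[t1 t2] := truncn_itv xh0.
have tn : (Num.truncn (x / h) < n)%N.
  rewrite -(ltr_nat R); apply: (le_lt_trans t1).
  by rewrite ltr_pdivrMr// mulrC /h divfK// gt_eqF.
exists (Ordinal tn) => j; rewrite mulrC -ler_pdivlMr// [h * _]mulrC -ltr_pdivrMr//.
rewrite -val_eqE /=; apply/andP/eqP => [[j1 j2]|->] //.
apply/eqP; rewrite eqn_leq -ltnS -[X in _ && X]ltnS -!(ltr_nat R).
by rewrite (le_lt_trans j1 t2) (le_lt_trans t1 j2).
Qed.

Lemma step_approx_dist a : torus a -> cmod (G a - step_approx a) <= C * (2 * h).
Proof.
move=> [/=]; rewrite !in_itv/= => /cell_index[i iE] /cell_index[j jE].
have -> : step_approx a = G (theta n i, theta n j).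
  rewrite /step_approx (bigD1 (i, j)) //= big1 => [|[i' j'] ne].
    rewrite addr0 indicE mem_set ?mulr1//; split => /=; rewrite in_itv/=.
      by rewrite iE.
    by rewrite jE.
  rewrite indicE memNset ?mulr0// => -[/=]; rewrite !in_itv/= iE jE => /eqP ii /eqP jj.
  by move/eqP: ne; rewrite ii jj.
apply: (le_trans (G_lipschitz _ _)); rewrite ler_wpM2l//=.
have hd k x : h * k%:R <= x < h * k.+1%:R -> `|x - theta n k| <= h.
  have -> : theta n k = h * k.+1%:R by rewrite /theta mulrAC.
  have -> : h * k.+1%:R = h * k%:R + h by rewrite -natr1 mulrDr mulr1.
  move=> /andP[x1 x2].
  by rewrite ler_norml; apply/andP; split; lra.
have := hd i a.1; rewrite iE => /(_ (eqxx _)) ?.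
have := hd j a.2; rewrite jE => /(_ (eqxx _)) ?.
lra.
Qed.

Lemma step_approx_integral : cintegrable torus step_approx /\
  cintegral torus step_approx =
  (h ^+ 2)%:C * \sum_(i < n) \sum_(j < n) G (theta n i, theta n j).
Proof.
have hk (k : 'I_n * 'I_n) := cintegral_indic (G (theta n k.1, theta n k.2)) measurable_torus
  (measurable_cell k) (@cell_torus k) torus_lty.
have [i1 i2] := cintegral_sum (index_enum ('I_n * 'I_n)%type) measurable_torus
  (fun k => (hk k).1).
split; first exact: i1.
rewrite [LHS]i2 pair_big /= mulr_sumr; apply: eq_bigr => k _.
by rewrite (hk k).2 cell_measure mulrC.
Qed.

End Step.

(* Measurability comes from the step functions, which converge pointwise. *)
Lemma torus_integrable : cintegrable torus G.
Proof.
have mS m : cmeasurable torus (step_approx m.+1).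
  have [[i1 i2] _] := step_approx_integral (ltn0Sn m).
  by split; apply/measurable_EFinP; [exact: (measurable_int mu i1)|exact: (measurable_int mu i2)].
(* [p] stands for the real or the imaginary part. *)
have lim (p : R[i] -> R) : (forall z w, `|p z - p w| <= cmod (z - w)) ->
    forall a, torus a -> (fun m => p (step_approx m.+1 a)) @ \oo --> p (G a).
  move=> pP a Ta; apply/cvgrPdist_lt => e e0.
  have [K [K0 hK]] : exists K : R, 0 < K /\
      forall m, `|p (G a) - p (step_approx m.+1 a)| <= K * m.+1%:R^-1.
    (* The added 1 keeps the constant positive when [C = 0]. *)
    exists (C * (2 * (2 * pi)) + 1); split.
      by rewrite ltr_wpDl// !mulr_ge0// pi_ge0.
    move=> m; apply: (le_trans (pP _ _)); apply: (le_trans (step_approx_dist (ltn0Sn m) Ta)).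
    by rewrite [leRHS]mulrDl mul1r -!mulrA lerDl invr_ge0.
  near=> m; apply: (le_lt_trans (hK m)); rewrite mulrC -ltr_pdivlMr//.
  by near: m; apply: near_infty_natSinv_lt (PosNum _); rewrite divr_gt0.
have mG : cmeasurable torus G.
  split.
    apply: (@measurable_fun_cvg _ _ _ _ (fun m a => complex.Re (step_approx m.+1 a))).
      by move=> m; have [] := mS m.
    by apply: lim => z w; rewrite -ReB normr_Re_le.
  apply: (@measurable_fun_cvg _ _ _ _ (fun m a => complex.Im (step_approx m.+1 a))).
    by move=> m; have [] := mS m.
  by apply: lim => z w; rewrite -ImB normr_Im_le.
pose M := cmod (G (0, 0)) + C * (2 * (2 * pi)).
apply: (cintegrable_le measurable_torus mG (integrable_cst_lty M measurable_torus torus_lty)).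
move=> a [/=]; rewrite !in_itv/= => /andP[a0 a1] /andP[b0 b1].
rewrite (_ : G a = G (0, 0) + (G a - G (0, 0))); last by rewrite addrC subrK.
apply: (le_trans (cmodD _ _)); rewrite /M lerD2l (le_trans (G_lipschitz _ _))// ler_wpM2l//=.
by rewrite !subr0 !ger0_norm//; lra.
Unshelve. all: by end_near. Qed.

(** The quadrature sum is the exact integral of the step function, so the error is at most the area
    of the torus times the uniform distance to [G]. *)
Lemma torus_quadrature n : (0 < n)%N ->
  cmod (cintegral torus G - (((2 * pi) / n%:R) ^+ 2)%:C *
    \sum_(i < n) \sum_(j < n) G (theta n i, theta n j))
  <= (2 * pi) ^+ 2 * (C * (2 * (2 * pi / n%:R))).
Proof.
move=> n0; have [iS <-] := step_approx_integral n0; have iG := torus_integrable.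
have mT := measurable_torus; rewrite -cintegralB//.
set M := C * _; have iM := integrable_cst_lty M mT torus_lty.
have -> : (2 * pi) ^+ 2 * M = \int[mu]_(y in torus) M.
  by rewrite (@Rintegral_cst _ _ _ mu torus mT) [X in fine X]torus_measure mulrC.
apply: (cmod_cintegral_le mT _ iM) => [|a Ta]; last exact: step_approx_dist.
have [i1 i2] := iG; have [j1 j2] := iS.
have k1 := @integrableB _ _ _ mu torus mT _ _ i1 j1.
have k2 := @integrableB _ _ _ mu torus mT _ _ i2 j2.
split.
  apply: (@eq_integrable _ _ _ mu torus mT _ _ _ k1) => y _.
  by rewrite [RHS]/= ReB EFinB.
apply: (@eq_integrable _ _ _ mu torus mT _ _ _ k2) => y _.
by rewrite [RHS]/= ImB EFinB.
Qed.

End TorusQuadrature.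

(** * Quadrature error for the adjoint operator *)

Section AdjointKernel.
Context {R : realType}.
Variables (gamma eta : R * R -> R[i]).
Hypotheses (gammaP : disc_Linfty gamma) (etaP : disc_Linfty eta).
Variables (omega : R) (omega_gt0 : 0 < omega).

Let N : R := disc_L1norm eta + disc_L1norm gamma.

Lemma data_le s t :
  cmod (Frow omega gamma eta (circle_pt s) (circle_pt t)) <= cmod (coef omega) * N.
Proof.
rewrite Frow_osc// cmodM ler_wpM2l ?cmod_ge0// osc_le//.
- exact: measurable_phase.
- by rewrite Normc.normc1.
- by rewrite cmodN cmodR dot_circle ler_norml cos_geN1 cos_le1.
Qed.

(** The integrand of [F1adj] for [p = 1] and of [F2adj] for [p = 0], up to constant factors and
    sign. *)
Definition adj_kernel (p : nat) (y0 x zeta : R * R) : R[i] :=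
  (dot x zeta ^+ p)%:C * expi (omega * dot (x - zeta) y0) *
  Frow omega gamma eta x zeta.

Lemma adj_kernel_lipschitz p y0 (a b : R * R) : (p <= 1)%N -> unit_disc y0 ->
  cmod (adj_kernel p y0 (circle_pt a.1) (circle_pt a.2) -
        adj_kernel p y0 (circle_pt b.1) (circle_pt b.2)) <=
  cmod (coef omega) * ((2 * omega + 1) * N) * (`|a.1 - b.1| + `|a.2 - b.2|).
Proof.
move=> p1 Dy0.
pose h (x zeta y : R * R) := omega * dot (x - zeta) y0 + phase omega x zeta y.
have mh x zeta : measurable_fun unit_disc (h x zeta).
  by apply: measurable_funD => //; exact: measurable_phase.
(* The data already carry the weights 1 and [- dot x zeta], so the weight of [gamma] has exponent
   [p.+1]. *)
have kE x zeta : adj_kernel p y0 x zeta =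
    coef omega * osc gamma eta (h x zeta) (dot x zeta ^+ p)%:C (- (dot x zeta ^+ p.+1)%:C).
  rewrite /adj_kernel Frow_osc// mulrCA mul_osc//; last exact: measurable_phase.
  by rewrite mulr1 mulrN -real_complexM -exprSr.
rewrite !kE -mulrBr cmodM -mulrA ler_wpM2l ?cmod_ge0// mulrAC.
set d := `|a.1 - b.1| + `|a.2 - b.2|.
have -> : (2 * omega + 1) * d = omega * (2 * d) + d by ring.
have cos1 (q : nat) (t : R) : `|cos t ^+ q| <= 1.
  by rewrite normrX exprn_ile1// ler_norml cos_geN1 cos_le1.
have hd : `|(a.1 - a.2) - (b.1 - b.2)| <= d.
  have -> : (a.1 - a.2) - (b.1 - b.2) = (a.1 - b.1) - (a.2 - b.2) by ring.
  exact: ler_normB.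
(* Only exponents up to 2 occur because [p <= 1], and all have Lipschitz constant at most 1. *)
have hcos (q : nat) : (q <= 2)%N ->
    `|cos (a.1 - a.2) ^+ q - cos (b.1 - b.2) ^+ q| <= d.
  case: q => [|[|[|//]]] _; last exact: le_trans (cos2_lipschitz _ _) hd.
    by rewrite subrr normr0 (le_trans (normr_ge0 _) hd).
  by rewrite !expr1; apply: le_trans hd; exact: cos_lipschitz.
rewrite !dot_circle; apply: osc_lipschitz => //; try exact: mh.
- by rewrite cmodR.
- by rewrite cmodN cmodR.
- by rewrite -(rmorphB (real_complex R)) cmodR hcos// leqW.
- by rewrite -opprD cmodN -(rmorphB (real_complex R)) cmodR hcos.
move=> y Dy.
have hE x zeta : h x zeta y = omega * dot (x - zeta) (y0 - y).
  by rewrite /h /phase /dot /=; ring.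
rewrite !hE -mulrBr normrM gtr0_norm// ler_pM2l//.
exact: dot_circle_lipschitz.
Qed.

Lemma adj_quadrature p y0 n : (p <= 1)%N -> unit_disc y0 -> (0 < n)%N ->
  cmod (torus_integral (adj_kernel p y0) - (((2 * pi) / n%:R) ^+ 2)%:C *
    \sum_(i < n) \sum_(j < n)
      adj_kernel p y0 (circle_pt (theta n i)) (circle_pt (theta n j)))
  <= (2 * pi) ^+ 2 * (cmod (coef omega) * ((2 * omega + 1) * N) * (2 * (2 * pi / n%:R))).
Proof.
move=> p1 Dy0 n0.
exact: (torus_quadrature (fun a b => adj_kernel_lipschitz a b p1 Dy0) n0).
Qed.

End AdjointKernel.

(** * Entries of the network *)

Section NetworkEntries.
Context {R : realType}.

(** The [j]-th diagonal entry of [K^* M K], with [M] the shifted input multiplied entrywise by the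
    [p]-th power of the cosine: [p = 1] for the first layer, up to sign, and [p = 0] for the
    second. *)
Definition sesq_sum (n nrho p : nat) (K : 'M[R[i]]_(n, nrho)) (L : 'M[R[i]]_n)
    (m : 'I_n) (j : 'I_nrho) : R[i] :=
  \sum_(i < n) \sum_(i' < n) (K i j)^*%C * K i' j *
    (cos (2 * pi * (i%:R - i'%:R) / n%:R) ^+ p)%:C * L (cyc_shift m i) (cyc_shift m i').

Lemma network_atE (omega1 omega : R) (n nrho n' : nat)
    (K : 'M[R[i]]_(n, nrho)) (L : 'M[R[i]]_n) :
  network_at omega1 n' omega K L =
  col_mx ((\matrix_m layer1 omega K (shifted m L)) *m Pomega omega1 nrho n' omega)
         ((\matrix_m layer2 omega K (shifted m L)) *m Pomega omega1 nrho n' omega).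
Proof.
rewrite /network_at; set A := \matrix_m _; set B := \matrix_m _; set P := Pomega _ _ _ _.
rewrite /Pu /Pl !tr_row_mx trmx1 trmx0.
rewrite !mul_col_mx (mul1mx A) (mul1mx B) (mul0mx _ A) (mul0mx _ B) (mul0mx _ P).

by rewrite add_col_mx addr0 add0r.
Qed.

Lemma mulmx_Pomega (omega1 omega : R) (n nrho n' : nat) (A : 'M[R[i]]_(n, nrho))
    (m : 'I_n) (k : 'I_n') (j : 'I_nrho) :
  j.+1%:R = omega / omega1 * k.+1%:R ->
  (A *m Pomega omega1 nrho n' omega) m k = A m j.
Proof.
move=> jk; rewrite !mxE (bigD1 j) //= big1 => [|j' jj].
  by rewrite mxE jk eqxx mulr1 addr0.
rewrite mxE -jk eqr_nat eqSS (_ : _ == _ = false) ?mulr0//.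
exact: negbTE jj.
Qed.

Lemma layer1E (omega : R) (n nrho : nat) (K : 'M[R[i]]_(n, nrho)) (L : 'M[R[i]]_n)
    (m : 'I_n) (j : 'I_nrho) :
  layer1 omega K (shifted m L) 0 j = - (layer_scale n omega * sesq_sum 1 K L m j).
Proof.
rewrite /layer1 !mxE -mulrN; congr (_ * _); rewrite /sesq_sum exchange_big /= -sumrN.
apply: eq_bigr => i' _; rewrite !mxE mulr_suml -sumrN; apply: eq_bigr => i _.
by rewrite !mxE expr1 (rmorphN (real_complex R)); ring.
Qed.

Lemma layer2E (omega : R) (n nrho : nat) (K : 'M[R[i]]_(n, nrho)) (L : 'M[R[i]]_n)
    (m : 'I_n) (j : 'I_nrho) :
  layer2 omega K (shifted m L) 0 j = layer_scale n omega * sesq_sum 0 K L m j.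
Proof.
rewrite /layer2 !mxE; congr (_ * _); rewrite /sesq_sum exchange_big /=.
apply: eq_bigr => i' _; rewrite !mxE mulr_suml; apply: eq_bigr => i _.
rewrite !mxE expr0; ring.
Qed.

Lemma cyc_shift_inj (n : nat) (m : 'I_n) : injective (cyc_shift m).
Proof.
move=> i j /(congr1 val) /= /eqP; rewrite eqn_modDr => /eqP.
by rewrite !modn_small// => /val_inj.
Qed.

(** The two angles differ by [2 pi] times the quotient of [i + m.+1] by [n]: a cyclic shift of
    indices is a rotation of the grid. *)
Lemma circle_pt_cyc_shift (n : nat) (m i : 'I_n) :
  circle_pt (theta n (cyc_shift m i)) = circle_pt (theta n i + theta n m) :> R * R.
Proof.
have n0 : (0 < n)%N by apply: leq_ltn_trans (ltn_ord i).
have n0' : n%:R != 0 :> R by rewrite pnatr_eq0 -lt0n.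
rewrite /circle_pt /polar !mul1r.
have -> : theta n i + theta n m =
    theta n (cyc_shift m i) + pi *+ 2 *+ ((i + m.+1) %/ n)%N :> R.
  have := divn_eq (i + m.+1) n => e.
  have e' : i%:R + m.+1%:R = ((i + m.+1) %/ n)%:R * n%:R + ((i + m.+1) %% n)%:R :> R.
    by rewrite -!natrD -natrM -natrD -e.
  have -> (q : nat) : pi *+ 2 *+ q = 2 * pi * q%:R :> R.
    by rewrite -[_ *+ q]mulr_natr -[pi *+ 2]mulr_natl.
  rewrite /theta /= -[i.+1%:R]natr1 -[(_ %% n).+1%:R]natr1.
  have -> : i%:R = ((i + m.+1) %/ n)%:R * n%:R + ((i + m.+1) %% n)%:R - m.+1%:R :> R.
    by rewrite -e' addrK.
  by field.
by rewrite (periodicn (@cosD2pi R)) (periodicn (@sinD2pi R)).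
Qed.

End NetworkEntries.

(** * Error of one layer at one frequency *)

Section LayerError.
Context {R : realType}.
Variables (omega1 omega2 : R) (gamma eta : R * R -> R[i]).
Hypotheses (gammaP : disc_Linfty gamma) (etaP : disc_Linfty eta).
Variables (n nrho : nat) (n_gt0 : (0 < n)%N).
Variables (Kr : 'M[R[i]]_(n, nrho)) (eps : R).
Let K := Kmx omega1 omega2 n nrho.
Hypothesis KrP : forall i i' j,
  cmod ((K i j)^*%C * K i' j - (Kr i j)^*%C * Kr i' j) <= 2 * eps.
Variables (omega : R) (omega_gt0 : 0 < omega).

Let N : R := disc_L1norm eta + disc_L1norm gamma.
Let h : R := 2 * pi / n%:R.
Let L := sample n (Frow omega gamma eta).

Lemma dot_circle_polar (s t rho : R) :
  dot (circle_pt s) (polar t rho) = rho * cos (s - t).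
Proof. by rewrite /dot /circle_pt /polar /= !mul1r cosB; ring. Qed.

(** Cyclic shifts permute the grid, so the sum of the adjoint integrand may be taken over rotated
    nodes. Relative to the output angle [theta n m], its oscillating factor becomes
    [conj (K i j) * K i' j], provided that column [j] has the matching radius. *)
Lemma sesq_sum_Kmx p (m : 'I_n) (j : 'I_nrho) rho :
  omega1 * Defs.radius omega1 omega2 nrho j = omega * rho ->
  sesq_sum p K L m j = \sum_(i < n) \sum_(i' < n)
    adj_kernel gamma eta omega p (polar (theta n m) rho)
      (circle_pt (theta n i)) (circle_pt (theta n i')).
Proof.
move=> jE; rewrite [RHS](reindex_inj (@cyc_shift_inj n m)) /=.
apply: eq_bigr => i _; rewrite [RHS](reindex_inj (@cyc_shift_inj n m)) /=.
apply: eq_bigr => i' _; rewrite [L _ _]mxE /adj_kernel; congr (_ * _).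
rewrite !circle_pt_cyc_shift dot_circle mulrC.
have -> : theta n i + theta n m - (theta n i' + theta n m) =
    2 * pi * (i%:R - i'%:R) / n%:R :> R.
  by rewrite /theta -[i.+1%:R]natr1 -[i'.+1%:R]natr1; field; rewrite pnatr_eq0 -lt0n.
congr (_ * _).
have -> (u v w : R * R) : dot (u - v) w = dot u w - dot v w by rewrite /dot /=; ring.
rewrite !dot_circle_polar !addrK /K !mxE /Defs.kernel jE conjc_expi -expiD; congr expi; ring.
Qed.

Lemma sesq_sum_error p (m : 'I_n) (j : 'I_nrho) :
  cmod (sesq_sum p K L m j - sesq_sum p Kr L m j) <=
  n%:R ^+ 2 * (2 * eps * (cmod (coef omega) * N)).
Proof.
rewrite /sesq_sum -sumrB; apply: (le_trans (cmod_sum _ _ _)).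
set M := 2 * eps * _; have -> : n%:R ^+ 2 * M = \sum_(i < n) \sum_(i' < n) M.
  by rewrite !sumr_const !card_ord -mulrnA -[RHS]mulr_natl natrM expr2.
apply: ler_sum => i _; rewrite -sumrB; apply: (le_trans (cmod_sum _ _ _)).
apply: ler_sum => i' _; rewrite -mulrBl -mulrBl !cmodM [L _ _]mxE.
apply: ler_pM; rewrite ?mulr_ge0 ?cmod_ge0//; last exact: data_le.
rewrite -[leRHS]mulr1; apply: ler_pM; rewrite ?cmod_ge0//.
by rewrite cmodR normrX exprn_ile1// ler_norml cos_geN1 cos_le1.
Qed.

Lemma layer_error p (m : 'I_n) (j : 'I_nrho) rho : (p <= 1)%N -> 0 <= rho <= 1 ->
  omega1 * Defs.radius omega1 omega2 nrho j = omega * rho ->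
  cmod ((coef omega)^*%C * torus_integral (adj_kernel gamma eta omega p (polar (theta n m) rho))
     - layer_scale n omega * sesq_sum p Kr L m j) <=
  8 * pi ^+ 2 * cmod (coef omega) ^+ 2 * ((4 * omega + 2) * pi / n%:R + eps) * N.
Proof.
move=> p1 /andP[rho0 rho1] jE.
have n0 : n%:R != 0 :> R by rewrite pnatr_eq0 -lt0n.
have -> : layer_scale n omega = (coef omega)^*%C * (h ^+ 2)%:C.
  rewrite /layer_scale mulrAC mulrC; congr (_ * _).
  have -> : h ^+ 2 = 4 * pi ^+ 2 * (n%:R ^+ 2)^-1 by rewrite /h; field.
  rewrite [RHS]real_complexM; congr (_ * _); apply/esym.
  by rewrite (fmorphV (real_complex R)) (rmorphXn (real_complex R)) (rmorph_nat (real_complex R)).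
rewrite -mulrA -mulrBr cmodM cmod_conj.
have Dy : unit_disc (polar (theta n m) rho).
  rewrite /unit_disc /dot /polar /= mulrACA [X in _ + X]mulrACA -mulrDr -!expr2 cos2Dsin2 mulr1.
  by rewrite exprn_ile1.
have hq := adj_quadrature gammaP etaP omega_gt0 p1 Dy n_gt0.
rewrite -(sesq_sum_Kmx p m jE) -/h in hq.
have he := sesq_sum_error p m j.
set T := torus_integral _ in hq *; set S := sesq_sum p K L m j in hq he.
(* Inserting the sum for the exact kernel separates the quadrature error from the compression
   error. *)
have -> : T - (h ^+ 2)%:C * sesq_sum p Kr L m j =
  (T - (h ^+ 2)%:C * S) + (h ^+ 2)%:C * (S - sesq_sum p Kr L m j) by ring.
have hh : cmod ((h ^+ 2)%:C * (S - sesq_sum p Kr L m j)) <=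
    h ^+ 2 * (n%:R ^+ 2 * (2 * eps * (cmod (coef omega) * N))).
  by rewrite cmodM cmodR ger0_norm ?sqr_ge0// ler_wpM2l ?sqr_ge0.
have c0 := cmod_ge0 (coef omega).
apply: (@le_trans _ _ (cmod (coef omega) *
  ((2 * pi) ^+ 2 * (cmod (coef omega) * ((2 * omega + 1) * N) * (2 * h)) +
   h ^+ 2 * (n%:R ^+ 2 * (2 * eps * (cmod (coef omega) * N)))))).
  by rewrite ler_wpM2l//; apply: (le_trans (cmodD _ _)); apply: lerD.
(* Equality holds: [(2 pi) ^ 2 (2 omega + 1) (4 pi / n) = 8 pi ^ 2 (4 omega + 2) pi / n] for the
   quadrature, and [h ^ 2 n ^ 2 * 2 eps = 8 pi ^ 2 eps] for the kernel. *)
rewrite le_eqVlt; apply/orP; left; apply/eqP; rewrite /h.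
by field.
Qed.

End LayerError.

(** * Assembly over both frequencies and both components *)

Lemma F1adj_kernel (R : realType) (omega : R) (gamma eta : R * R -> R[i]) (y : R * R) :
  F1adj omega (Frow omega gamma eta) y =
  - ((coef omega)^*%C * torus_integral (adj_kernel gamma eta omega 1 y)).
Proof.
rewrite /F1adj mulNr /adj_kernel.
by under [in RHS]eq_fun do under eq_fun do rewrite expr1.
Qed.

Lemma F2adj_kernel (R : realType) (omega : R) (gamma eta : R * R -> R[i]) (y : R * R) :
  F2adj omega (Frow omega gamma eta) y =
  (coef omega)^*%C * torus_integral (adj_kernel gamma eta omega 0 y).
Proof.
rewrite /F2adj; congr (_ * torus_integral _).
by apply/funext => x; apply/funext => z; rewrite /adj_kernel expr0 mul1r.
Qed.

Theorem theorem3p2 (R : realType) (omega1 omega2 : R)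
  (omega1_gt0 : 0 < omega1) (omega12 : omega1 < omega2)
  (ratio_nat : omega2 / omega1 \is a Num.nat)
  (ntheta nrho n' : nat) (ntheta_gt0 : (0 < ntheta)%N)
  (ntheta_le_nrho : (ntheta <= nrho)%N)
  (n'E : n'%:R = omega1 / omega2 * nrho%:R :> R)
  (gamma eta : R * R -> R[i])
  (gamma_Linfty : disc_Linfty gamma) (eta_Linfty : disc_Linfty eta)
  (r nr : nat) (r_gt0 : (0 < r)%N) (nr_gt0 : (0 < nr)%N)
  (nr_ntheta : (nr %| ntheta)%N) (nr_nrho : (nr %| nrho)%N)
  (cr : R) (cr_gt0 : 0 < cr)
  (crE : nr%:R ^+ (2 * r) = cr * ntheta%:R) :
  let L1 := Frow omega1 gamma eta in
  let L2 := Frow omega2 gamma eta in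
  let Lam := discrete_input ntheta L1 L2 in
  let Phi := discrete_output omega1 omega2 ntheta nrho n' L1 L2 in
  exists Kr : 'M[R[i]]_(ntheta, nrho),
    let phi1 := network omega1 omega2 n' Kr in
    [/\ forall a b : 'I_nr, (\rank (block nr_ntheta nr_nrho Kr a b) <= r)%N,
        maxnorm (Kmx omega1 omega2 ntheta nrho - Kr) <=
          (pi / 2 * omega2) ^+ r / r`!%:R / nr%:R ^+ (2 * r) &
        maxnorm (Phi - phi1 Lam) <=
          c_bf1 omega1 omega2 r cr gamma eta / ntheta%:R].
Proof.
move=> L1 L2 Lam Phi.
have w20 : 0 < omega2 by exact: lt_trans omega12.
have nrho0 : (0 < nrho)%N by exact: leq_trans ntheta_le_nrho.
have [Kr [Krank Kdist Kprod]] := low_rank_kernel nr_ntheta nr_nrho omega1_gt0 w20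
  ntheta_gt0 nrho0 r_gt0 nr_gt0.
set eps := (pi / 2 * omega2) ^+ r / r`!%:R / nr%:R ^+ (2 * r) in Kdist Kprod.
have eps0 : 0 <= eps.
  by rewrite !divr_ge0 ?exprn_ge0 ?mulr_ge0 ?pi_ge0 ?invr_ge0// ltW.
exists Kr; split => //.
  by apply: maxnorm_le => // i j; rewrite !mxE; have := Kdist i j; rewrite mxE.
set N := disc_L1norm eta + disc_L1norm gamma.
have N0 : 0 <= N by rewrite addr_ge0// disc_L1norm_ge0.
pose E w := 8 * pi ^+ 2 * cmod (coef w) ^+ 2 * ((4 * w + 2) * pi / ntheta%:R + eps) * N.
have nrho0' : 0 < nrho%:R :> R by rewrite ltr0n.
have nt0' : 0 < ntheta%:R :> R by rewrite ltr0n.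
have w21 : 0 < omega2 / omega1 by rewrite divr_gt0.
have rhoP (k : 'I_n') : 0 <= Defs.radius omega1 omega2 nrho k <= 1.
  rewrite /Defs.radius; apply/andP; split; first by rewrite mulr_ge0 ?divr_ge0// ltW.
  apply: (@le_trans _ _ (omega2 / omega1 * (n'%:R / nrho%:R))).
    by rewrite ler_pM2l// ler_pM2r ?invr_gt0// ler_nat.
  (* The last output radius, of index [n'], is exactly 1, so all output points lie in the disc. *)
  by rewrite n'E le_eqVlt; apply/orP; left; apply/eqP; field; rewrite !gt_eqF.
have colP w : w = omega1 \/ w = omega2 -> forall k : 'I_n', exists j : 'I_nrho,
    j.+1%:R = w / omega1 * k.+1%:R.
  have n'0 : n'%:R <= nrho%:R :> R.
    rewrite n'E -[leRHS]mul1r ler_pM2r// ler_pdivrMr// mul1r ltW//.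
  case=> -> k.
    have kn : (k < nrho)%N by rewrite (leq_trans (ltn_ord k))// -(ler_nat R).
    by exists (Ordinal kn); rewrite divff ?gt_eqF// mul1r.
  (* For [omega2] the selected column is [q] times the output index, with [q = omega2 / omega1]; the
     predecessor below converts it to an index from 0. *)
  have [q qE] := natrP ratio_nat.
  have qk : (0 < q * k.+1)%N by rewrite muln_gt0 andbT -(ltr_nat R) -qE.
  have jn : ((q * k.+1).-1 < nrho)%N.
    rewrite prednK// -(ler_nat R) natrM -qE (_ : nrho%:R = omega2 / omega1 * n'%:R).
      by rewrite ler_pM2l// ler_nat.
    by rewrite n'E; field; rewrite !gt_eqF.
  by exists (Ordinal jn); rewrite /= prednK// natrM qE.
have colrho w (k : 'I_n') (j : 'I_nrho) : j.+1%:R = w / omega1 * k.+1%:R ->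
    omega1 * Defs.radius omega1 omega2 nrho j = w * Defs.radius omega1 omega2 nrho k.
  by move=> jk; rewrite /Defs.radius jk; field; rewrite !gt_eqF.
have err w p (m : 'I_ntheta) (k : 'I_n') (j : 'I_nrho) :
    0 < w -> (p <= 1)%N -> j.+1%:R = w / omega1 * k.+1%:R ->
    cmod ((coef w)^*%C * torus_integral (adj_kernel gamma eta w p
        (polar (theta ntheta m) (Defs.radius omega1 omega2 nrho k)))
      - layer_scale ntheta w * sesq_sum p Kr (sample ntheta (Frow w gamma eta)) m j) <= E w.
  move=> w0 p1 jk; apply: (layer_error gamma_Linfty eta_Linfty ntheta_gt0 Kprod) => //.
  exact: colrho.
have errU w : w = omega1 \/ w = omega2 -> forall (m : 'I_ntheta) (k : 'I_n'),
    cmod (F1adj w (Frow w gamma eta) (polar (theta ntheta m) (Defs.radius omega1 omega2 nrho k)) -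
      ((\matrix_m layer1 w Kr (shifted m (sample ntheta (Frow w gamma eta)))) *m
        Pomega omega1 nrho n' w) m k) <= E w.
  move=> wP m k; have [j jk] := colP _ wP k.
  have w0 : 0 < w by case: wP => ->.
  (* The minus sign of [F1adj] matches the one that [Cmx] puts in front of the cosine. *)
  rewrite (mulmx_Pomega _ m jk) mxE layer1E F1adj_kernel -opprB cmodN opprK addrC.
  exact: err.
have errL w : w = omega1 \/ w = omega2 -> forall (m : 'I_ntheta) (k : 'I_n'),
    cmod (F2adj w (Frow w gamma eta) (polar (theta ntheta m) (Defs.radius omega1 omega2 nrho k)) -
      ((\matrix_m layer2 w Kr (shifted m (sample ntheta (Frow w gamma eta)))) *m
        Pomega omega1 nrho n' w) m k) <= E w.
  move=> wP m k; have [j jk] := colP _ wP k.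
  have w0 : 0 < w by case: wP => ->.
  by rewrite (mulmx_Pomega _ m jk) mxE layer2E F2adj_kernel; exact: err.
have cc w : 0 <= 8 * pi ^+ 2 * cmod (coef w) ^+ 2.
  by apply: mulr_ge0; [apply: mulr_ge0|]; rewrite // sqr_ge0.
have Ebound : E omega1 + E omega2 <= c_bf1 omega1 omega2 r cr gamma eta / ntheta%:R.
  have -> : c_bf1 omega1 omega2 r cr gamma eta / ntheta%:R =
    8 * pi ^+ 2 * cmod (coef omega1) ^+ 2 * ((4 * omega2 + 3) * pi / ntheta%:R + eps) * N +
    8 * pi ^+ 2 * cmod (coef omega2) ^+ 2 * ((4 * omega2 + 3) * pi / ntheta%:R + eps) * N.
    (* Here [crE] turns [nr ^ (2 r)] into [cr * ntheta], so [eps] also decays like [1 / ntheta]. *)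
    rewrite /c_bf1 -/N /eps crE; field.
    by rewrite !gt_eqF// ltr0n fact_gt0.
  (* Both frequencies are at most [omega2], and [4 w + 2 <= 4 omega2 + 3]. *)
  have EE w : w <= omega2 -> E w <=
    8 * pi ^+ 2 * cmod (coef w) ^+ 2 * ((4 * omega2 + 3) * pi / ntheta%:R + eps) * N.
    move=> ww; rewrite /E ler_wpM2r// ler_wpM2l ?cc//.
    by rewrite lerD2r ler_pM2r ?invr_gt0// ler_pM2r ?pi_gt0//; lra.
  by apply: lerD; apply: EE => //; exact: ltW.
apply: le_trans Ebound; have E0 w : 0 < w -> 0 <= E w.
  move=> w0; rewrite /E mulr_ge0// mulr_ge0 ?cc// addr_ge0// divr_ge0// mulr_ge0 ?pi_ge0//.
  by rewrite addr_ge0// mulr_ge0// ltW.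
apply: maxnorm_le => [|i k]; first by rewrite addr_ge0// E0.
rewrite /Phi /discrete_output /Lam /discrete_input /network col_mxKu col_mxKd !network_atE.
rewrite add_col_mx opp_col_mx add_col_mx -(fintype.splitK i); case: (fintype.split i) => m.
  rewrite col_mxEu mxE [(\matrix_(_, _) _) _ _]mxE  [X in _ + X]mxE [X in _ - X]mxE.
  rewrite /Fstar1 opprD addrACA.
  apply: (le_trans (cmodD _ _)); apply: lerD; first by apply: errU; left.
  by apply: errU; right.
rewrite col_mxEd mxE [(\matrix_(_, _) _) _ _]mxE [X in _ + X]mxE [X in _ - X]mxE.
rewrite /Fstar2 opprD addrACA.
apply: (le_trans (cmodD _ _)); apply: lerD; first by apply: errL; left.
by apply: errL; right.
Qed.
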